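(* Let $f\colon\mathbb{D}\to\mathbb{D}$ be holomorphic and without fixed points in $\mathbb{D}$. Then the following statements are equivalent: (i) there exists $z_0\in\mathbb{D}$ such that $s^f(z_0)=0$; (ii) any left straightening of $\{f^n\}$ is constant; (iii) $\lim_{n\to+\infty}\omega\bigl(f^n(z),f^n(w)\bigr)=0$ for all $z,w\in\mathbb{D}$; (iv) $s^f\equiv 0$.
   Context: $\mathbb{D}=\{z\in\mathbb{C} : |z|<1\}$; $\mathrm{Aut}(\mathbb{D})$ is the group of biholomorphic self-maps of $\mathbb{D}$; $f^n$ is the $n$-th iterate of $f$. The Poincaré distance on $\mathbb{D}$ is $\omega(z_1,z_2)=\tanh^{-1}\left|\frac{z_2-z_1}{1-\overline{z_1}z_2}\right|$, where $\tanh^{-1}t=\frac12\log\frac{1+t}{1-t}$. A left straightening of the sequence of iterates $\{f^n\}$ is a holomorphic map $h\colon\mathbb{D}\to\mathbb{D}$ for which there is a sequence $\{\gamma_n\}\subset\mathrm{Aut}(\mathbb{D})$ such that $\gamma_n^{-1}\circ f^n\to h$ uniformly on compact subsets of $\mathbb{D}$. The hyperbolic step of $f$ is the function $s^f\colon\mathbb{D}\to[0,+\infty)$, $s^f(z)=\lim_{n\to+\infty}\omega\bigl(f^n(z),f^{n+1}(z)\bigr)$; the limit exists because, by the Schwarz-Pick theorem, the sequence is non-increasing. *)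

(* Defs.v *)
(* Stdlib reals, with Coquelicot for the complex plane and limits. *)
From Stdlib Require Import Reals List.
From Coquelicot Require Import Coquelicot.
Open Scope R_scope.

Definition unit_disc (z : C) : Prop := Cmod z < 1.

(* A map between discs is a total function C -> C of which only the values on
   the disc matter. *)
Definition holomorphic_self_map (f : C -> C) : Prop :=
  (forall z : C, unit_disc z -> unit_disc (f z)) /\
  (forall z : C, unit_disc z -> @ex_derive C_AbsRing C_NormedModule f z).

Record disc_aut : Type := DiscAut {
  aut_fun :> C -> C;
  aut_inv : C -> C;
  aut_fun_holomorphic : holomorphic_self_map aut_fun;
  aut_inv_holomorphic : holomorphic_self_map aut_inv;
  aut_funK : forall z : C, unit_disc z -> aut_inv (aut_fun z) = z;
  aut_invK : forall z : C, unit_disc z -> aut_fun (aut_inv z) = z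
}.

Definition iterate (f : C -> C) (n : nat) (z : C) : C := Nat.iter n f z.

Definition artanh (t : R) : R := / 2 * ln ((1 + t) / (1 - t)).

Definition poincare_dist (z1 z2 : C) : R :=
  artanh (Cmod ((z2 - z1) / (1 - Cconj z1 * z2))%C).

Definition compact_set (K : C -> Prop) : Prop :=
  forall (I : Type) (U : I -> C -> Prop),
    (forall i : I, open (U i)) ->
    (forall z : C, K z -> exists i : I, U i z) ->
    exists l : list I, forall z : C, K z -> exists i : I, In i l /\ U i z.

Definition cvg_compacts_disc (g : nat -> C -> C) (h : C -> C) : Prop :=
  forall K : C -> Prop,
    compact_set K -> (forall z : C, K z -> unit_disc z) ->
    forall eps : R, 0 < eps ->
    exists N : nat, forall n : nat, (N <= n)%nat ->
    forall z : C, K z -> Cmod (g n z - h z)%C < eps.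

Definition left_straightening (f h : C -> C) : Prop :=
  holomorphic_self_map h /\
  exists gamma : nat -> disc_aut,
    cvg_compacts_disc (fun n z => aut_inv (gamma n) (iterate f n z)) h.

Definition constant_on_disc (h : C -> C) : Prop :=
  exists c : C, forall z : C, unit_disc z -> h z = c.

(* For a holomorphic self-map f of the disc and z in the disc, the sequence is
   nonincreasing and nonnegative, so Lim_seq is its true limit.  The value is
   left in Rbar: projecting it to R would send infinite limits to 0. *)
Definition hyperbolic_step (f : C -> C) (z : C) : Rbar :=
  Lim_seq (fun n => poincare_dist (iterate f n z) (iterate f (S n) z)).

(* Main.v *)
Require Import Defs.
From Stdlib Require Import Reals List Lra Lia.
From Stdlib Require Import Classical IndefiniteDescription.
From Coquelicot Require Import Coquelicot.
Open Scope R_scope.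

(** Let [d z w] be the limit of the pseudo-hyperbolic distances of [f^n z] and
    [f^n w], which decrease by the Schwarz-Pick lemma; the Poincare distances tend
    to [0] exactly when [d z w = 0].

    The proof rests on a quantitative rigidity of Schwarz's lemma
    ([schwarz_rigidity]): if a self-map [H] of the disc fixes [0] and
    [|H a| / |a|] is close to [1], then [H] is close to a rotation on every
    pseudo-hyperbolic disc about [a].  Indeed [H z / z] is again bounded by [1],
    so the Schwarz-Pick lemma applies to it.

    From (i) to (ii): if the orbit of [z0] has zero step and [d z0 w > 0] for some
    [w], then late iterates of [z0] and [w] are almost at their final distance, so
    all further iterates of [f] are almost isometric near the orbit of [z0]; they
    cannot contract the positive distance between two successive points of that
    orbit to [0] ([orbits_merge_of_zero_step]).  So [d z0] vanishes identically,
    and a limit of straightened iterates is constant ([straightening_constant]).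

    From (ii) to (iii): if [d z0 w0 > 0], rotate and translate the iterates so that
    [z0] goes to [0] and [w0] to a positive number.  Rigidity shows that this
    sequence is Cauchy uniformly on compact sets, and its limit is a left
    straightening that separates [z0] from [w0] ([nonconstant_straightening]).

    From (iii) to (iv) take [w = f z], and (iv) contains (i).

    The complex analysis is built on one maximum principle ([maximum_principle])
    for continuous functions that are differentiable off a finite set.
    It comes from the mean value property on circles, that is, from Goursat's
    theorem in logarithmic polar coordinates.  Applied to slopes
    [(f w - f z) / (w - z)], it gives Schwarz's lemma and the differentiability of
    uniform limits. *)

(** * Goursat's theorem on rectangles *)

(** A counterexample rectangle always has a counterexample quarter, and the
    nested counterexamples shrink to a point, where the local hypothesis
    contradicts them.  Every rectangle is a copy of the initial one scaled by
    [h], so shapes stay bounded.  It serves both for Goursat's theorem and for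
    the existence of maxima on discs. *)
Lemma quarter_bisection (P : R -> R -> R -> Prop) (A B x0 y0 : R) :
  0 <= A -> 0 <= B ->
  (forall x y h, 0 < h ->
    P x y (h / 2) -> P (x + h / 2 * A) y (h / 2) ->
    P x (y + h / 2 * B) (h / 2) -> P (x + h / 2 * A) (y + h / 2 * B) (h / 2) ->
    P x y h) ->
  (forall a b, x0 <= a <= x0 + A -> y0 <= b <= y0 + B ->
    exists delta, 0 < delta /\ forall x y h, 0 < h < delta ->
      x <= a <= x + h * A -> y <= b <= y + h * B -> P x y h) ->
  P x0 y0 1.
Proof.
  intros HA HB Hsplit Hloc. apply NNPP; intro Hbad.
  set (rel := fun s s' : R * R * R =>
    let '(x, y, h) := s in let '(x', y', h') := s' in
    0 < h -> ~ P x y h ->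
    ~ P x' y' h' /\ h' = h / 2 /\ x <= x' /\ x' + h' * A <= x + h * A /\
    y <= y' /\ y' + h' * B <= y + h * B).
  destruct (functional_choice rel) as [step Hstep].
  { intros [[x y] h].
    destruct (classic (0 < h /\ ~ P x y h)) as [[Hh Hn]|Hn].
    2:{ exists (x, y, h). simpl. intros; tauto. }
    assert (HhA : 0 <= h / 2 * A) by (apply Rmult_le_pos; lra).
    assert (HhB : 0 <= h / 2 * B) by (apply Rmult_le_pos; lra).
    assert (EA : h * A = h / 2 * A + h / 2 * A) by field.
    assert (EB : h * B = h / 2 * B + h / 2 * B) by field.
    destruct (classic (P x y (h / 2))) as [P1|P1].
    2:{ exists (x, y, h / 2). simpl. intros; repeat split; lra || assumption. }
    destruct (classic (P (x + h / 2 * A) y (h / 2))) as [P2|P2].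
    2:{ exists (x + h / 2 * A, y, h / 2). simpl.
        intros; repeat split; lra || assumption. }
    destruct (classic (P x (y + h / 2 * B) (h / 2))) as [P3|P3].
    2:{ exists (x, y + h / 2 * B, h / 2). simpl.
        intros; repeat split; lra || assumption. }
    destruct (classic (P (x + h / 2 * A) (y + h / 2 * B) (h / 2))) as [P4|P4].
    2:{ exists (x + h / 2 * A, y + h / 2 * B, h / 2). simpl.
        intros; repeat split; lra || assumption. }
    destruct Hn; now apply Hsplit. }
  set (s := fun n => Nat.iter n step (x0, y0, 1)).
  set (X := fun n => fst (fst (s n))). set (Y := fun n => snd (fst (s n))).
  set (H := fun n => snd (s n)).
  assert (Hinv : forall n, H n = (/ 2) ^ n /\ ~ P (X n) (Y n) (H n)).
  { induction n as [|n [IH1 IH2]].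
    - split; [reflexivity | exact Hbad].
    - unfold X, Y, H in *. unfold s in *. simpl.
      generalize (Hstep (Nat.iter n step (x0, y0, 1))).
      destruct (Nat.iter n step (x0, y0, 1)) as [[x y] h]. simpl in *.
      destruct (step (x, y, h)) as [[x' y'] h']. simpl.
      assert (0 < (/2)^n) by (apply pow_lt; lra).
      intro Hs. destruct Hs as (Hs1 & Hs2 & _); [lra | assumption |].
      split; [lra | assumption]. }
  assert (Hmon : forall n, X n <= X (S n) /\ X (S n) + H (S n) * A <= X n + H n * A
     /\ Y n <= Y (S n) /\ Y (S n) + H (S n) * B <= Y n + H n * B).
  { intro n. destruct (Hinv n) as [IH1 IH2]. revert IH1 IH2.
    unfold X, Y, H. unfold s. simpl.
    generalize (Hstep (Nat.iter n step (x0, y0, 1))).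
    destruct (Nat.iter n step (x0, y0, 1)) as [[x y] h]. simpl.
    destruct (step (x, y, h)) as [[x' y'] h']. simpl.
    intros Hs IH1 IH2. assert (0 < (/2)^n) by (apply pow_lt; lra).
    destruct Hs as (_ & _ & Hs); [lra | assumption | exact Hs]. }
  assert (Hpos : forall n, 0 < H n).
  { intro n. rewrite (proj1 (Hinv n)). apply pow_lt; lra. }
  (* The corners of nested rectangles converge to a common point. *)
  assert (Hlim : forall (Z : nat -> R) (D : R), 0 <= D ->
    (forall n, Z n <= Z (S n) /\ Z (S n) + H (S n) * D <= Z n + H n * D) ->
    exists c, forall n, Z n <= c <= Z n + H n * D).
  { intros Z D HD HZ.
    assert (Hup : forall n m, Z n <= Z (n + m)%nat).
    { intros n m; induction m as [|m IH].
      - rewrite Nat.add_0_r; lra.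
      - rewrite Nat.add_succ_r. destruct (HZ (n + m)%nat); lra. }
    assert (Hdn : forall n m, Z (n + m)%nat + H (n + m)%nat * D <= Z n + H n * D).
    { intros n m; induction m as [|m IH].
      - rewrite Nat.add_0_r; lra.
      - rewrite Nat.add_succ_r. destruct (HZ (n + m)%nat); lra. }
    assert (Hle : forall n m, Z m <= Z n + H n * D).
    { intros n m.
      assert (H0 := Hpos (n + m)%nat).
      assert (0 <= H (n + m)%nat * D) by (apply Rmult_le_pos; lra).
      assert (H2 := Hdn n m). assert (H3 := Hup m n).
      rewrite Nat.add_comm in H3. lra. }
    destruct (ex_finite_lim_seq_incr Z (Z 0%nat + H 0%nat * D)) as [c Hc].
    - intro n; apply HZ.
    - intro n; apply Hle.
    - exists c. intro n. split.
      + apply (is_lim_seq_incr_compare Z); [exact Hc | intro; apply HZ].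
      + change (Rbar_le c (Z n + H n * D)).
        apply (is_lim_seq_le Z (fun _ => Z n + H n * D)); [apply Hle | exact Hc |].
        apply is_lim_seq_const. }
  destruct (Hlim X A HA) as [a Ha]; [intro n; split; apply Hmon |].
  destruct (Hlim Y B HB) as [b Hb]; [intro n; split; apply Hmon |].
  destruct (Hloc a b) as [delta [Hd Hdelta]].
  { destruct (Ha 0%nat) as [H1 H2]. unfold X, H, s in H1, H2. simpl in *. lra. }
  { destruct (Hb 0%nat) as [H1 H2]. unfold Y, H, s in H1, H2. simpl in *. lra. }
  destruct (pow_lt_1_zero (/ 2) ltac:(rewrite Rabs_right; lra) delta Hd) as [N HN].
  specialize (HN N (le_n N)). destruct (Hinv N) as [HHN HP]. apply HP.
  apply Hdelta; [| apply Ha | apply Hb].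
  split; [apply Hpos |]. rewrite HHN. rewrite Rabs_right in HN; [exact HN |].
  apply Rle_ge, Rlt_le, pow_lt; lra.
Qed.

Lemma differentiable_pt_lim_continuous_l (u : R -> R -> R) x y a b :
  differentiable_pt_lim u x y a b -> continuous (fun s => u s y) x.
Proof.
  intro Hd. apply (ex_derive_continuous (fun s => u s y) x).
  exists (a * 1 + b * 0).
  apply is_derive_Reals.
  apply (derivable_pt_lim_comp_2d u (fun s => s) (fun _ => y)); [exact Hd | |].
  - apply derivable_pt_lim_id.
  - apply derivable_pt_lim_const.
Qed.

Lemma differentiable_pt_lim_continuous_r (u : R -> R -> R) x y a b :
  differentiable_pt_lim u x y a b -> continuous (fun t => u x t) y.
Proof.
  intro Hd. apply (ex_derive_continuous (fun t => u x t) y).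
  exists (a * 0 + b * 1).
  apply is_derive_Reals.
  apply (derivable_pt_lim_comp_2d u (fun _ => x) (fun t => t)); [exact Hd | |].
  - apply derivable_pt_lim_const.
  - apply derivable_pt_lim_id.
Qed.

Lemma RInt_minus_const_bound (f g : R -> R) (a b k e : R) : a <= b ->
  ex_RInt f a b -> ex_RInt g a b ->
  (forall t, a <= t <= b -> Rabs (f t - g t - k) <= e) ->
  Rabs (RInt f a b - RInt g a b - k * (b - a)) <= e * (b - a).
Proof.
  intros Hab Hf Hg Hb.
  assert (Hfg : ex_RInt (fun t => f t - g t) a b)
    by (apply (ex_RInt_minus (V := R_NormedModule)); assumption).
  assert (Hk : ex_RInt (fun _ : R => k) a b) by apply ex_RInt_const.
  assert (E : RInt (fun t => f t - g t - k) a b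
              = RInt f a b - RInt g a b - k * (b - a)).
  { rewrite (RInt_minus (V := R_CompleteNormedModule) (fun t => f t - g t) (fun _ => k));
      try assumption.
    rewrite (RInt_minus (V := R_CompleteNormedModule) f g); try assumption.
    rewrite RInt_const. unfold minus, plus, opp, scal; simpl.
    unfold mult; simpl. ring. }
  rewrite <- E, Rmult_comm. apply abs_RInt_le_const; try assumption.
  apply (ex_RInt_minus (V := R_NormedModule)); assumption.
Qed.

(** The vanishing of the circulation of [v dx + u dy], a closed form because
    [u_x = v_y].  On a small rectangle of size [h] the two first-order
    expansions contribute the same main term [u_x] times the area, so the
    circulation is at most [eps h^2]; circulations add up under subdivision.
    Subdivision takes the place of differentiation under the integral sign, which
    would need continuous partial derivatives. *)
Lemma goursat_rectangle (u v : R -> R -> R) (x0 x1 y0 y1 : R) :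
  x0 <= x1 -> y0 <= y1 ->
  (forall x y, x0 <= x <= x1 -> y0 <= y <= y1 ->
    exists a b c, differentiable_pt_lim u x y a b /\ differentiable_pt_lim v x y c a) ->
  RInt (fun y => u x1 y) y0 y1 - RInt (fun y => u x0 y) y0 y1 =
  RInt (fun x => v x y1) x0 x1 - RInt (fun x => v x y0) x0 x1.
Proof.
  intros Hx Hy Hd.
  assert (IU : forall x y y', x0 <= x <= x1 -> y0 <= y <= y1 -> y0 <= y' <= y1 ->
    ex_RInt (fun t => u x t) y y').
  { intros x y y' H H1 H2. apply (ex_RInt_continuous (V := R_CompleteNormedModule)). intros t Ht.
    destruct (Hd x t) as (a & b & c & Hu & _); [assumption | |].
    - revert Ht; unfold Rmin, Rmax; destruct (Rle_dec y y'); lra.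
    - eapply differentiable_pt_lim_continuous_r; exact Hu. }
  assert (IV : forall y x x', y0 <= y <= y1 -> x0 <= x <= x1 -> x0 <= x' <= x1 ->
    ex_RInt (fun t => v t y) x x').
  { intros y x x' H H1 H2. apply (ex_RInt_continuous (V := R_CompleteNormedModule)). intros t Ht.
    destruct (Hd t y) as (a & b & c & _ & Hv); [ | assumption |].
    - revert Ht; unfold Rmin, Rmax; destruct (Rle_dec x x'); lra.
    - eapply differentiable_pt_lim_continuous_l; exact Hv. }
  set (A := x1 - x0). set (B := y1 - y0).
  set (Phi := fun x y h =>
    (RInt (fun t => u (x + h * A) t) y (y + h * B) - RInt (fun t => u x t) y (y + h * B))
    - (RInt (fun t => v t (y + h * B)) x (x + h * A) - RInt (fun t => v t y) x (x + h * A))).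
  assert (HA : 0 <= A) by (unfold A; lra). assert (HB : 0 <= B) by (unfold B; lra).
  assert (Hall : forall eps, 0 < eps -> Rabs (Phi x0 y0 1) <= eps * (1 * 1)).
  { intros eps Heps.
    set (P := fun x y h => x0 <= x -> x + h * A <= x1 -> y0 <= y -> y + h * B <= y1 ->
       Rabs (Phi x y h) <= eps * (h * h)).
    enough (Hsub : P x0 y0 1) by (apply Hsub; unfold A, B; lra).
    apply (quarter_bisection P A B x0 y0 HA HB); unfold P; clear P.
    - intros x y h Hh P1 P2 P3 P4 Hx1 Hx2 Hy1 Hy2.
      assert (HhA : 0 <= h / 2 * A) by (apply Rmult_le_pos; lra).
      assert (HhB : 0 <= h / 2 * B) by (apply Rmult_le_pos; lra).
      assert (EA : h * A = h / 2 * A + h / 2 * A) by field.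
      assert (EB : h * B = h / 2 * B + h / 2 * B) by field.
      specialize (P1 ltac:(lra) ltac:(lra) ltac:(lra) ltac:(lra)).
      specialize (P2 ltac:(lra) ltac:(lra) ltac:(lra) ltac:(lra)).
      specialize (P3 ltac:(lra) ltac:(lra) ltac:(lra) ltac:(lra)).
      specialize (P4 ltac:(lra) ltac:(lra) ltac:(lra) ltac:(lra)).
      assert (E : Phi x y h = Phi x y (h / 2) + Phi (x + h / 2 * A) y (h / 2)
         + Phi x (y + h / 2 * B) (h / 2) + Phi (x + h / 2 * A) (y + h / 2 * B) (h / 2)).
      { unfold Phi.
        rewrite EA, EB, <- (Rplus_assoc x), <- (Rplus_assoc y).
        set (xm := x + h / 2 * A) in *. set (ym := y + h / 2 * B) in *.
        set (xe := xm + h / 2 * A) in *. set (ye := ym + h / 2 * B) in *.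
        assert (x <= xm <= xe /\ y <= ym <= ye /\ xe <= x1 /\ ye <= y1)
          by (unfold xe, xm, ye, ym in *; lra).
        pose proof (RInt_Chasles (V := R_CompleteNormedModule) (fun t => u xe t) y ym ye ltac:(apply IU; lra) ltac:(apply IU; lra)) as C1.
        pose proof (RInt_Chasles (V := R_CompleteNormedModule) (fun t => u x t) y ym ye ltac:(apply IU; lra) ltac:(apply IU; lra)) as C2.
        pose proof (RInt_Chasles (V := R_CompleteNormedModule) (fun t => v t ye) x xm xe ltac:(apply IV; lra) ltac:(apply IV; lra)) as C3.
        pose proof (RInt_Chasles (V := R_CompleteNormedModule) (fun t => v t y) x xm xe ltac:(apply IV; lra) ltac:(apply IV; lra)) as C4.
        unfold plus in *; simpl in *. lra. }
      rewrite E. eapply Rle_trans; [apply Rabs_triang |].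
      eapply Rle_trans; [apply Rplus_le_compat_r, Rabs_triang |].
      eapply Rle_trans; [apply Rplus_le_compat_r, Rplus_le_compat_r, Rabs_triang |].
      assert (eps * (h * h) = 4 * (eps * (h / 2 * (h / 2)))) by field. lra.
    - intros a b Ha Hb.
      destruct (Hd a b) as (p & q & r & Hu & Hv); [unfold A in *; lra | unfold B in *; lra |].
      (* The four sides each contribute an error e h (A + B) times their length. *)
      set (K := 4 * (A + B) * (A + B) + 1).
      assert (HK : 0 < K) by (unfold K; nra).
      set (e := eps / K).
      assert (He : 0 < e) by (apply Rdiv_lt_0_compat; lra).
      destruct (Hu (mkposreal e He)) as [du Hdu].
      destruct (Hv (mkposreal e He)) as [dv Hdv]. simpl in Hdu, Hdv.
      set (d := Rmin du dv / (A + B + 1)).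
      assert (Hm : 0 < Rmin du dv) by (apply Rmin_pos; apply cond_pos).
      exists d. split; [apply Rdiv_lt_0_compat; lra |].
      intros x y h Hh Hxa Hyb Hx1 Hx2 Hy1 Hy2.
      assert (HhA : 0 <= h * A) by (apply Rmult_le_pos; lra).
      assert (HhB : 0 <= h * B) by (apply Rmult_le_pos; lra).
      assert (Hsz : h * A + h * B < Rmin du dv).
      { replace (Rmin du dv) with (d * (A + B + 1)) by (unfold d; field; lra). nra. }
      assert (Hsu := Rmin_l du dv). assert (Hsv := Rmin_r du dv).
      assert (Hnear : forall s t, x <= s <= x + h * A -> y <= t <= y + h * B ->
        Rabs (s - a) <= h * (A + B) /\ Rabs (t - b) <= h * (A + B)).
      { intros s t Hs Ht. split; apply Rabs_le; lra. }
      assert (Hest : forall (w : R -> R -> R) m n (dw : posreal), Rmin du dv <= dw ->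
        (forall s t, Rabs (s - a) < dw -> Rabs (t - b) < dw ->
          Rabs (w s t - w a b - (m * (s - a) + n * (t - b))) <= e * Rmax (Rabs (s - a)) (Rabs (t - b))) ->
        forall s t, x <= s <= x + h * A -> y <= t <= y + h * B ->
          Rabs (w s t - w a b - (m * (s - a) + n * (t - b))) <= e * (h * (A + B))).
      { intros w m n dw Hdw Hw s t Hs Ht. destruct (Hnear s t Hs Ht) as [N1 N2].
        eapply Rle_trans; [apply Hw; lra |].
        apply Rmult_le_compat_l; [lra |]. apply Rmax_lub; assumption. }
      assert (HU := Hest u p q du Hsu Hdu). assert (HV := Hest v r p dv Hsv Hdv).
      assert (BU : Rabs (RInt (fun t => u (x + h * A) t) y (y + h * B)
         - RInt (fun t => u x t) y (y + h * B) - p * (h * A) * (y + h * B - y))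
         <= (2 * (e * (h * (A + B)))) * (y + h * B - y)).
      { apply RInt_minus_const_bound; [lra | apply IU; lra | apply IU; lra |].
        intros t Ht.
        assert (E1 := HU (x + h * A) t ltac:(lra) ltac:(lra)).
        assert (E2 := HU x t ltac:(lra) ltac:(lra)).
        apply Rabs_le_between in E1. apply Rabs_le_between in E2. apply Rabs_le. lra. }
      assert (BV : Rabs (RInt (fun t => v t (y + h * B)) x (x + h * A)
         - RInt (fun t => v t y) x (x + h * A) - p * (h * B) * (x + h * A - x))
         <= (2 * (e * (h * (A + B)))) * (x + h * A - x)).
      { apply RInt_minus_const_bound; [lra | apply IV; lra | apply IV; lra |].
        intros t Ht.
        assert (E1 := HV t (y + h * B) ltac:(lra) ltac:(lra)).
        assert (E2 := HV t y ltac:(lra) ltac:(lra)).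
        apply Rabs_le_between in E1. apply Rabs_le_between in E2. apply Rabs_le. lra. }
      assert (HF : Rabs (Phi x y h) <= 2 * (e * (h * (A + B))) * (h * (A + B))).
      { unfold Phi. apply Rabs_le_between in BU. apply Rabs_le_between in BV.
        apply Rabs_le. lra. }
      eapply Rle_trans; [exact HF |].
      replace (2 * (e * (h * (A + B))) * (h * (A + B)))
        with (e * (2 * (A + B) * (A + B)) * (h * h)) by ring.
      apply Rmult_le_compat_r; [nra |].
      replace eps with (e * K) by (unfold e; field; lra).
      apply Rmult_le_compat_l; [lra |]. unfold K; nra. }
  assert (H0 : Phi x0 y0 1 = 0).
  { destruct (Req_dec (Phi x0 y0 1) 0) as [|Hn]; [assumption |].
    assert (Hp := Rabs_pos_lt _ Hn).
    assert (Hq := Hall (Rabs (Phi x0 y0 1) / 2) ltac:(lra)). lra. }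
  unfold Phi in H0.
  replace (x0 + 1 * A) with x1 in H0 by (unfold A; ring).
  replace (y0 + 1 * B) with y1 in H0 by (unfold B; ring). lra.
Qed.

(** * Complex differentiability through slopes *)

(** Continuity and differentiability are phrased with the modulus, since every
    estimate below is one. *)
Definition ccont (f : C -> C) (z : C) : Prop :=
  forall eps, 0 < eps -> exists delta, 0 < delta /\
    forall w, Cmod (w - z)%C < delta -> Cmod (f w - f z)%C < eps.

(** The difference quotient completed by [L] at the centre.  It is both the
    device that defines the derivative and the function to which the maximum
    principle is applied. *)
Definition slope (f : C -> C) (z L w : C) : C :=
  if Ceq_dec w z then L else ((f w - f z) / (w - z))%C.

Definition cdiff (f : C -> C) (z L : C) : Prop := ccont (slope f z L) z.

Lemma Cminus_diag (z : C) : (z - z)%C = 0.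
Proof. ring. Qed.

Lemma Cminus_neq_0 (w z : C) : w <> z -> (w - z)%C <> 0.
Proof.
  intros H E. apply H. replace w with ((w - z) + z)%C by ring. rewrite E. ring.
Qed.

Lemma Cmod_minus_eq_0 (w z : C) : Cmod (w - z)%C = 0 -> w = z.
Proof.
  intro H. apply Cmod_eq_0 in H. replace w with ((w - z) + z)%C by ring.
  rewrite H. ring.
Qed.

Lemma Cmod_minus_sym (w z : C) : Cmod (w - z)%C = Cmod (z - w)%C.
Proof. rewrite <- Cmod_opp. f_equal. ring. Qed.

Lemma Cmod_triangle_sub (a b c : C) : Cmod (a - c)%C <= Cmod (a - b)%C + Cmod (b - c)%C.
Proof. replace (a - c)%C with ((a - b) + (b - c))%C by ring. apply Cmod_triangle. Qed.

Lemma Cmod_le_add_sub (a b : C) : Cmod a <= Cmod b + Cmod (a - b)%C.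
Proof. replace a with (b + (a - b))%C at 1 by ring. apply Cmod_triangle. Qed.

Lemma sqrt2_lt_2 : sqrt 2 < 2.
Proof. rewrite <- (sqrt_square 2) at 2 by lra. apply sqrt_lt_1; lra. Qed.

Lemma slope_diag f z L : slope f z L z = L.
Proof. unfold slope. destruct (Ceq_dec z z); [reflexivity | congruence]. Qed.

Lemma slope_spec f z L w : (f w - f z = slope f z L w * (w - z))%C.
Proof.
  unfold slope. destruct (Ceq_dec w z) as [->|H]; [ring |].
  field. now apply Cminus_neq_0.
Qed.

Lemma ccont_ext_loc (f g : C -> C) z d : 0 < d ->
  (forall w, Cmod (w - z)%C < d -> f w = g w) -> ccont f z -> ccont g z.
Proof.
  intros Hd E Hf eps He. destruct (Hf eps He) as [e [He' H]].
  exists (Rmin d e). split; [now apply Rmin_pos |].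
  intros w Hw. rewrite <- !E; [| rewrite Cminus_diag, Cmod_0; lra |].
  - apply H. eapply Rlt_le_trans; [exact Hw | apply Rmin_r].
  - eapply Rlt_le_trans; [exact Hw | apply Rmin_l].
Qed.

Lemma ccont_const c z : ccont (fun _ => c) z.
Proof.
  intros eps He. exists 1. split; [lra |]. intros. rewrite Cminus_diag, Cmod_0. lra.
Qed.

Lemma ccont_id z : ccont (fun w => w) z.
Proof. intros eps He. exists eps. split; auto. Qed.

Lemma ccont_plus f g z : ccont f z -> ccont g z -> ccont (fun w => f w + g w)%C z.
Proof.
  intros Hf Hg eps He.
  destruct (Hf (eps / 2)) as [d1 [Hd1 H1]]; [lra |].
  destruct (Hg (eps / 2)) as [d2 [Hd2 H2]]; [lra |].
  exists (Rmin d1 d2). split; [now apply Rmin_pos |]. intros w Hw.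
  assert (A1 := H1 w (Rlt_le_trans _ _ _ Hw (Rmin_l _ _))).
  assert (A2 := H2 w (Rlt_le_trans _ _ _ Hw (Rmin_r _ _))).
  replace (f w + g w - (f z + g z))%C with ((f w - f z) + (g w - g z))%C by ring.
  eapply Rle_lt_trans; [apply Cmod_triangle | lra].
Qed.

Lemma ccont_mult f g z : ccont f z -> ccont g z -> ccont (fun w => f w * g w)%C z.
Proof.
  intros Hf Hg eps He.
  set (K := Cmod (f z) + Cmod (g z) + 1).
  assert (P1 := Cmod_ge_0 (f z)). assert (P2 := Cmod_ge_0 (g z)).
  assert (HK : 0 < K) by (unfold K; lra).
  set (e := Rmin 1 (eps / (2 * K))).
  assert (Hq : 0 < eps / (2 * K)) by (apply Rdiv_lt_0_compat; lra).
  assert (He' : 0 < e) by (apply Rmin_pos; lra).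
  assert (He1 : e <= 1) by apply Rmin_l.
  assert (He2 : e * (2 * K) <= eps).
  { replace eps with (eps / (2 * K) * (2 * K)) by (field; lra).
    apply Rmult_le_compat_r; [lra | apply Rmin_r]. }
  destruct (Hf e He') as [d1 [Hd1 H1]].
  destruct (Hg e He') as [d2 [Hd2 H2]].
  exists (Rmin d1 d2). split; [now apply Rmin_pos |]. intros w Hw.
  assert (A1 := H1 w (Rlt_le_trans _ _ _ Hw (Rmin_l _ _))).
  assert (A2 := H2 w (Rlt_le_trans _ _ _ Hw (Rmin_r _ _))).
  replace (f w * g w - f z * g z)%C
    with ((f w - f z) * (g w - g z) + ((f w - f z) * g z + f z * (g w - g z)))%C by ring.
  eapply Rle_lt_trans; [apply Cmod_triangle |].
  eapply Rle_lt_trans; [apply Rplus_le_compat_l, Cmod_triangle |].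
  rewrite !Cmod_mult.
  set (a := Cmod (f w - f z)%C) in *. set (b := Cmod (g w - g z)%C) in *.
  assert (0 <= a) by apply Cmod_ge_0. assert (0 <= b) by apply Cmod_ge_0.
  unfold K in He2. nra.
Qed.

Lemma ccont_inv (f : C -> C) z : f z <> 0 -> ccont f z -> ccont (fun w => / f w)%C z.
Proof.
  intros Hz Hf eps He.
  set (m := Cmod (f z)). assert (Hm : 0 < m) by exact (proj1 (Cmod_gt_0 _) Hz).
  set (e := Rmin (m / 2) (eps * (m * m) / 2)).
  assert (He' : 0 < e).
  { apply Rmin_pos; [lra |]. apply Rdiv_lt_0_compat; [| lra].
    repeat apply Rmult_lt_0_compat; assumption. }
  destruct (Hf e He') as [d [Hd H]]. exists d. split; [exact Hd |].
  intros w Hw. specialize (H w Hw).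
  assert (E1 : e <= m / 2) by apply Rmin_l.
  assert (E2 : e <= eps * (m * m) / 2) by apply Rmin_r.
  assert (Hw' : m / 2 < Cmod (f w)).
  { assert (T := Cmod_le_add_sub (f z) (f w)). rewrite Cmod_minus_sym in T.
    fold m in T. lra. }
  assert (Hn : f w <> 0) by (apply Cmod_gt_0; lra).
  replace (/ f w - / f z)%C with (- ((f w - f z) / (f w * f z)))%C
    by (field; split; assumption).
  rewrite Cmod_opp, Cmod_div, Cmod_mult; [| apply Cmult_neq_0; assumption].
  fold m. apply Rmult_lt_reg_r with (Cmod (f w) * m).
  { apply Rmult_lt_0_compat; lra. }
  unfold Rdiv. rewrite Rmult_assoc, Rinv_l, Rmult_1_r; [| apply Rgt_not_eq; nra].
  apply Rlt_le_trans with e; [exact H |].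
  eapply Rle_trans; [exact E2 |].
  replace (eps * (m * m) / 2) with (eps * (m / 2 * m)) by field.
  apply Rmult_le_compat_l; [lra |]. apply Rmult_le_compat_r; lra.
Qed.

Lemma ccont_comp f g z : ccont g z -> ccont f (g z) -> ccont (fun w => f (g w)) z.
Proof.
  intros Hg Hf eps He. destruct (Hf eps He) as [d [Hd H]].
  destruct (Hg d Hd) as [e [He' H']]. exists e. split; auto.
Qed.

Lemma ccont_minus f g z : ccont f z -> ccont g z -> ccont (fun w => f w - g w)%C z.
Proof.
  intros Hf Hg. apply (ccont_ext_loc (fun w => f w + (-(1)) * g w)%C _ z 1); [lra | |].
  - intros; ring.
  - apply ccont_plus; [exact Hf |]. apply ccont_mult; [apply ccont_const | exact Hg].
Qed.

(** Caratheodory: to differentiate it is enough to factor the increment through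
    [w - z] with a continuous cofactor, so differentiation rules reduce to
    algebra. *)
Lemma cdiff_factor (f phi : C -> C) z d : 0 < d -> ccont phi z ->
  (forall w, Cmod (w - z)%C < d -> f w - f z = phi w * (w - z))%C ->
  cdiff f z (phi z).
Proof.
  intros Hd Hphi E. apply (ccont_ext_loc phi _ z d Hd); [| exact Hphi].
  intros w Hw. unfold slope. destruct (Ceq_dec w z) as [->|Hn]; [reflexivity |].
  rewrite (E w Hw). field. now apply Cminus_neq_0.
Qed.

Lemma cdiff_ccont f z L : cdiff f z L -> ccont f z.
Proof.
  intro H. apply (ccont_ext_loc (fun w => f z + slope f z L w * (w - z))%C _ z 1); [lra | |].
  - intros w _. rewrite <- slope_spec. ring.
  - apply ccont_plus; [apply ccont_const |].
    apply ccont_mult; [exact H |].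
    apply ccont_minus; [apply ccont_id | apply ccont_const].
Qed.

Lemma cdiff_ext_loc f g z L d : 0 < d ->
  (forall w, Cmod (w - z)%C < d -> f w = g w) -> cdiff f z L -> cdiff g z L.
Proof.
  intros Hd E H. rewrite <- (slope_diag f z L).
  apply (cdiff_factor g (slope f z L) z d Hd); [exact H |].
  intros w Hw. rewrite <- !E; [apply slope_spec | | exact Hw].
  rewrite Cminus_diag, Cmod_0; lra.
Qed.

Lemma cdiff_const c z : cdiff (fun _ => c) z 0.
Proof.
  apply (cdiff_factor _ (fun _ => RtoC 0) z 1); [lra | apply ccont_const |].
  intros; ring.
Qed.

Lemma cdiff_id z : cdiff (fun w => w) z 1.
Proof.
  apply (cdiff_factor _ (fun _ => RtoC 1) z 1); [lra | apply ccont_const |].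
  intros; ring.
Qed.

Lemma cdiff_plus f g z L M : cdiff f z L -> cdiff g z M ->
  cdiff (fun w => f w + g w)%C z (L + M)%C.
Proof.
  intros Hf Hg. rewrite <- (slope_diag f z L), <- (slope_diag g z M).
  apply (cdiff_factor _ (fun w => slope f z L w + slope g z M w)%C z 1); [lra | |].
  - now apply ccont_plus.
  - intros w _. rewrite Cmult_plus_distr_r, <- !slope_spec. ring.
Qed.

Lemma cdiff_mult f g z L M : cdiff f z L -> cdiff g z M ->
  cdiff (fun w => f w * g w)%C z (L * g z + f z * M)%C.
Proof.
  intros Hf Hg.
  replace (L * g z + f z * M)%C
    with ((fun w => slope f z L w * g w + f z * slope g z M w)%C z)
    by (rewrite !slope_diag; reflexivity).
  apply (cdiff_factor _ (fun w => slope f z L w * g w + f z * slope g z M w)%C z 1); [lra | |].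
  - apply ccont_plus; apply ccont_mult; try assumption.
    + eapply cdiff_ccont; exact Hg.
    + apply ccont_const.
  - intros w _.
    transitivity ((f w - f z) * g w + f z * (g w - g z))%C; [ring |].
    rewrite (slope_spec f z L), (slope_spec g z M). ring.
Qed.

Lemma cdiff_minus f g z L M : cdiff f z L -> cdiff g z M ->
  cdiff (fun w => f w - g w)%C z (L - M)%C.
Proof.
  intros Hf Hg. rewrite <- (slope_diag f z L), <- (slope_diag g z M).
  apply (cdiff_factor _ (fun w => slope f z L w - slope g z M w)%C z 1); [lra | |].
  - now apply ccont_minus.
  - intros w _.
    transitivity ((f w - f z) - (g w - g z))%C; [ring |].
    rewrite (slope_spec f z L), (slope_spec g z M). ring.
Qed.

Lemma cdiff_inv (f : C -> C) z L : f z <> 0 -> cdiff f z L ->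
  cdiff (fun w => / f w)%C z (- (L / (f z * f z)))%C.
Proof.
  intros Hz Hf. assert (Hc := cdiff_ccont f z L Hf).
  destruct (Hc (Cmod (f z))) as [d [Hd H]]; [now apply Cmod_gt_0 |].
  rewrite <- (slope_diag f z L) at 1.
  apply (cdiff_factor _ (fun w => - (slope f z L w / (f w * f z)))%C z d Hd).
  - apply (ccont_ext_loc (fun w => (- / f z) * (slope f z L w * / f w))%C _ z d Hd).
    + intros w Hw. assert (f w <> 0).
      { intro E. specialize (H w Hw). rewrite E in H.
        replace (0 - f z)%C with (- f z)%C in H by ring.
        rewrite Cmod_opp in H. lra. }
      field. split; assumption.
    + apply ccont_mult; [apply ccont_const |].
      apply ccont_mult; [exact Hf |]. now apply ccont_inv.
  - intros w Hw. assert (f w <> 0).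
    { intro E. specialize (H w Hw). rewrite E in H.
      replace (0 - f z)%C with (- f z)%C in H by ring.
      rewrite Cmod_opp in H. lra. }
    transitivity (- ((f w - f z) / (f w * f z)))%C; [field; split; assumption |].
    rewrite (slope_spec f z L). field. split; assumption.
Qed.

Lemma cdiff_comp f g z L M : cdiff g z M -> cdiff f (g z) L ->
  cdiff (fun w => f (g w)) z (L * M)%C.
Proof.
  intros Hg Hf.
  replace (L * M)%C with ((fun w => slope f (g z) L (g w) * slope g z M w)%C z)
    by (simpl; rewrite !slope_diag; reflexivity).
  apply (cdiff_factor _ (fun w => slope f (g z) L (g w) * slope g z M w)%C z 1); [lra | |].
  - apply ccont_mult; [| exact Hg].
    apply (ccont_comp (slope f (g z) L) g); [eapply cdiff_ccont; exact Hg | exact Hf].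
  - intros w _. rewrite (slope_spec f (g z) L (g w)), (slope_spec g z M w). ring.
Qed.

(** Off its centre the slope is a quotient of differentiable functions. *)
Lemma cdiff_slope f z L w L' : w <> z -> cdiff f w L' ->
  exists M, cdiff (slope f z L) w M.
Proof.
  intros Hn Hf. eexists.
  apply (cdiff_ext_loc (fun v => (f v - f z) * / (v - z))%C _ w _ (Cmod (w - z)%C)).
  - now apply Cmod_gt_0, Cminus_neq_0.
  - intros v Hv. unfold slope. destruct (Ceq_dec v z) as [->|]; [| reflexivity].
    rewrite Cmod_minus_sym in Hv. lra.
  - apply cdiff_mult.
    + apply cdiff_minus; [exact Hf | apply cdiff_const].
    + apply cdiff_inv; [now apply Cminus_neq_0 |].
      apply cdiff_minus; [apply cdiff_id | apply cdiff_const].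
Qed.

Lemma cdiff_estimate f z L : cdiff f z L <->
  forall eps, 0 < eps -> exists delta, 0 < delta /\ forall w, Cmod (w - z)%C < delta ->
    Cmod (f w - f z - L * (w - z))%C <= eps * Cmod (w - z)%C.
Proof.
  split; intros H eps He.
  - destruct (H eps He) as [d [Hd Hs]]. exists d. split; [exact Hd |].
    intros w Hw. rewrite (slope_spec f z L).
    replace (slope f z L w * (w - z) - L * (w - z))%C
      with ((slope f z L w - L) * (w - z))%C by ring.
    rewrite Cmod_mult. apply Rmult_le_compat_r; [apply Cmod_ge_0 |].
    specialize (Hs w Hw). rewrite slope_diag in Hs. lra.
  - destruct (H (eps / 2)) as [d [Hd Hs]]; [lra |]. exists d. split; [exact Hd |].
    intros w Hw. rewrite slope_diag. specialize (Hs w Hw).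
    destruct (Ceq_dec w z) as [->|Hn].
    { rewrite slope_diag, Cminus_diag, Cmod_0. exact He. }
    assert (Hp : 0 < Cmod (w - z)%C) by now apply Cmod_gt_0, Cminus_neq_0.
    rewrite (slope_spec f z L) in Hs.
    replace (slope f z L w * (w - z) - L * (w - z))%C
      with ((slope f z L w - L) * (w - z))%C in Hs by ring.
    rewrite Cmod_mult in Hs. apply Rmult_le_reg_r in Hs; lra.
Qed.

Lemma cdiff_is_derive f z L :
  cdiff f z L <-> @is_derive C_AbsRing C_NormedModule f z L.
Proof.
  rewrite cdiff_estimate. split.
  - intro H. split; [apply is_linear_scal_l |].
    intros x Hx eps.
    assert (Ex : x = z).
    { symmetry. apply (is_filter_lim_locally_unique (V := AbsRing_NormedModule C_AbsRing) z x Hx). }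
    subst x.
    destruct (H eps (cond_pos eps)) as [d [Hd Hs]].
    exists (mkposreal d Hd). intros y Hy.
    specialize (Hs y Hy).
    replace (y - z)%C with (minus (G := C_AbsRing) y z) in Hs by reflexivity.
    rewrite Cmult_comm in Hs. exact Hs.
  - intros [_ H] eps He.
    specialize (H z (fun P HP => HP) (mkposreal eps He)).
    destruct H as [d Hs]. exists d. split; [apply cond_pos |].
    intros w Hw. specialize (Hs w Hw). rewrite (Cmult_comm L). exact Hs.
Qed.

(** * The mean value property *)

Lemma differentiable_pt_lim_of_estimate (h : C -> R) z a b :
  (forall eps, 0 < eps -> exists delta, 0 < delta /\ forall w, Cmod (w - z)%C < delta ->
    Rabs (h w - h z - (a * Re (w - z)%C + b * Im (w - z)%C)) <= eps * Cmod (w - z)%C) ->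
  differentiable_pt_lim (fun x y => h (x, y)) (Re z) (Im z) a b.
Proof.
  intros H eps.
  destruct (H (eps / 2)) as [d [Hd Hs]]; [destruct eps; simpl; lra |].
  assert (Hd2 : 0 < d / 2) by lra.
  assert (Hs2 : sqrt 2 < 2) by apply sqrt2_lt_2.
  exists (mkposreal _ Hd2). simpl. intros x y Hx Hy.
  set (w := (x, y) : C).
  assert (Ez : z = (Re z, Im z)) by (destruct z; reflexivity).
  assert (Hm : Cmod (w - z)%C <= 2 * Rmax (Rabs (x - Re z)) (Rabs (y - Im z))).
  { eapply Rle_trans; [apply Cmod_2Rmax |]. rewrite Ez. simpl.
    apply Rmult_le_compat_r; [| lra].
    eapply Rle_trans; [apply Rabs_pos | apply Rmax_l]. }
  assert (Hm2 : Rmax (Rabs (x - Re z)) (Rabs (y - Im z)) < d / 2) by now apply Rmax_lub_lt.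
  assert (Hb := Hs w ltac:(lra)).
  rewrite <- Ez. change (Re (w - z)%C) with (x - Re z) in Hb.
  change (Im (w - z)%C) with (y - Im z) in Hb.
  eapply Rle_trans; [exact Hb |].
  replace (eps * Rmax (Rabs (x - Re z)) (Rabs (y - Im z)))
    with (eps / 2 * (2 * Rmax (Rabs (x - Re z)) (Rabs (y - Im z)))) by field.
  apply Rmult_le_compat_l; [destruct eps; simpl; lra | exact Hm].
Qed.

Lemma im_le_Cmod (c : C) : Rabs (Im c) <= Cmod c.
Proof.
  eapply Rle_trans; [| apply Rmax_Cmod]. apply Rmax_r.
Qed.

Lemma cdiff_Re f z L : cdiff f z L ->
  differentiable_pt_lim (fun x y => Re (f (x, y))) (Re z) (Im z) (Re L) (- Im L).
Proof.
  intro H. apply (differentiable_pt_lim_of_estimate (fun w => Re (f w))).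
  intros eps He. destruct (proj1 (cdiff_estimate f z L) H eps He) as [d [Hd Hs]].
  exists d. split; [exact Hd |]. intros w Hw.
  eapply Rle_trans; [| apply (Hs w Hw)].
  eapply Rle_trans; [| apply re_le_Cmod]. apply Req_le. f_equal.
  destruct (f w), (f z), L, w, z. unfold Re, Im. simpl. ring.
Qed.

Lemma cdiff_Im f z L : cdiff f z L ->
  differentiable_pt_lim (fun x y => Im (f (x, y))) (Re z) (Im z) (Im L) (Re L).
Proof.
  intro H. apply (differentiable_pt_lim_of_estimate (fun w => Im (f w))).
  intros eps He. destruct (proj1 (cdiff_estimate f z L) H eps He) as [d [Hd Hs]].
  exists d. split; [exact Hd |]. intros w Hw.
  eapply Rle_trans; [| apply (Hs w Hw)].
  eapply Rle_trans; [| apply im_le_Cmod]. apply Req_le. f_equal.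
  destruct (f w), (f z), L, w, z. unfold Re, Im. simpl. ring.
Qed.

Lemma differentiable_pt_lim_mult x y : differentiable_pt_lim Rmult x y y x.
Proof.
  intro eps. exists eps. intros u v Hu Hv.
  replace (u * v - x * y - (y * (u - x) + x * (v - y))) with ((u - x) * (v - y)) by ring.
  rewrite Rabs_mult.
  apply Rmult_le_compat; [apply Rabs_pos | apply Rabs_pos | lra | apply Rmax_r].
Qed.

Lemma differentiable_pt_lim_sep (a b : R) (f g : R -> R) x y df dg :
  derivable_pt_lim f x df -> derivable_pt_lim g y dg ->
  differentiable_pt_lim (fun s t => a + f s * g t) x y (df * g y) (f x * dg).
Proof.
  intros Hf Hg.
  assert (Hs : differentiable_pt_lim (fun s _ => f s) x y df 0)
    by now apply differentiable_pt_lim_proj1_0.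
  assert (Ht : differentiable_pt_lim (fun _ t => g t) x y 0 dg).
  { intro eps. 
    destruct (differentiable_pt_lim_proj1_0 g y x dg Hg eps) as [d Hd].
    exists d. intros u v Hu Hv.
    replace (0 * (u - x) + dg * (v - y)) with (dg * (v - y) + 0 * (u - x)) by ring.
    rewrite Rmax_comm. now apply Hd. }
  assert (H := differentiable_pt_lim_comp Rmult (fun s _ => f s) (fun _ t => g t)
    x y _ _ _ _ _ _ (differentiable_pt_lim_mult (f x) (g y)) Hs Ht).
  intro eps. destruct (H eps) as [d Hd]. exists d. intros u v Hu Hv.
  specialize (Hd u v Hu Hv).
  replace (a + f u * g v - (a + f x * g y) - (df * g y * (u - x) + f x * dg * (v - y)))
    with (f u * g v - f x * g y - ((g y * df + f x * 0) * (u - x) + (g y * 0 + f x * dg) * (v - y)))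
    by ring.
  exact Hd.
Qed.

Definition circle_point (p : C) (r t : R) : C := (Re p + r * cos t, Im p + r * sin t).

Lemma circle_point_mod p r t : 0 <= r -> Cmod (circle_point p r t - p)%C = r.
Proof.
  intro Hr. unfold Cmod, circle_point, Re, Im. simpl.
  replace ((fst p + r * cos t + - fst p) * ((fst p + r * cos t + - fst p) * 1) +
    (snd p + r * sin t + - snd p) * ((snd p + r * sin t + - snd p) * 1))
    with (r * r * (Rsqr (sin t) + Rsqr (cos t))) by (unfold Rsqr; ring).
  rewrite sin2_cos2, Rmult_1_r. now apply sqrt_square.
Qed.

(** In the coordinates [z = p + exp (s + i t)] the Cauchy-Riemann equation keeps
    its Cartesian form [u_s = v_t], because the exponential is holomorphic. *)
Lemma cauchy_riemann_log_polar g p L s t : cdiff g (circle_point p (exp s) t) L ->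
  exists a b c,
    differentiable_pt_lim (fun s t => Re (g (circle_point p (exp s) t))) s t a b /\
    differentiable_pt_lim (fun s t => Im (g (circle_point p (exp s) t))) s t c a.
Proof.
  intro H.
  assert (HX := differentiable_pt_lim_sep (Re p) 0 exp cos s t _ _
    (derivable_pt_lim_exp s) (derivable_pt_lim_cos t)).
  assert (HY := differentiable_pt_lim_sep (Im p) 0 exp sin s t _ _
    (derivable_pt_lim_exp s) (derivable_pt_lim_sin t)).
  assert (HU := differentiable_pt_lim_comp _ _ _ s t _ _ _ _ _ _ (cdiff_Re _ _ _ H) HX HY).
  assert (HV := differentiable_pt_lim_comp _ _ _ s t _ _ _ _ _ _ (cdiff_Im _ _ _ H) HX HY).
  eexists _, _, _. split; [exact HU |].
  match type of HV with differentiable_pt_lim _ _ _ _ ?b =>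
    match goal with |- differentiable_pt_lim _ _ _ _ ?a => replace a with b by ring end end.
  exact HV.
Qed.

(** Goursat's theorem on the log-polar rectangle [s, ln r] x [0, 2 pi]: the
    imaginary part has equal values on the two horizontal sides by periodicity,
    so the circular means at the radii [exp s] and [r] agree.  The centre
    corresponds to [s = -oo], which is why continuity suffices there. *)
Lemma mean_value_circle (g : C -> C) (p : C) (r : R) : 0 < r ->
  ccont g p ->
  (forall z, 0 < Cmod (z - p)%C <= r -> exists L, cdiff g z L) ->
  ex_RInt (fun t => Re (g (circle_point p r t))) 0 (2 * PI) /\
  RInt (fun t => Re (g (circle_point p r t))) 0 (2 * PI) = 2 * PI * Re (g p).
Proof.
  intros Hr Hc Hd.
  assert (HPI := PI_RGT_0).
  set (U := fun s t => Re (g (circle_point p (exp s) t))).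
  set (V := fun s t => Im (g (circle_point p (exp s) t))).
  assert (HUV : forall s t, s <= ln r -> exists a b c,
    differentiable_pt_lim U s t a b /\ differentiable_pt_lim V s t c a).
  { intros s t Hs. assert (He := exp_pos s).
    destruct (Hd (circle_point p (exp s) t)) as [L HL].
    - rewrite circle_point_mod by lra. split; [exact He |].
      rewrite <- (exp_ln r Hr). destruct Hs as [Hs| ->]; [| lra].
      left; now apply exp_increasing.
    - exact (cauchy_riemann_log_polar g p L s t HL). }
  assert (HI : forall s, s <= ln r -> ex_RInt (U s) 0 (2 * PI)).
  { intros s Hs. apply (ex_RInt_continuous (V := R_CompleteNormedModule)).
    intros t _. destruct (HUV s t Hs) as (a & b & c & Hu & _).
    exact (differentiable_pt_lim_continuous_r U s t a b Hu). }
  assert (Hconst : forall s, s <= ln r -> RInt (U (ln r)) 0 (2 * PI) = RInt (U s) 0 (2 * PI)).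
  { intros s Hs.
    assert (G := goursat_rectangle U V s (ln r) 0 (2 * PI) Hs ltac:(lra)
      (fun x y Hx _ => HUV x y (proj2 Hx))).
    assert (E : RInt (fun x => V x (2 * PI)) s (ln r) = RInt (fun x => V x 0) s (ln r)).
    { apply RInt_ext. intros x _. unfold V, circle_point.
      now rewrite cos_2PI, sin_2PI, cos_0, sin_0. }
    rewrite E in G. change (fun y => U (ln r) y) with (U (ln r)) in G.
    change (fun y => U s y) with (U s) in G. lra. }
  replace (fun t => Re (g (circle_point p r t))) with (U (ln r))
    by (unfold U; now rewrite exp_ln).
  split; [apply HI; lra |].
  apply Rminus_diag_uniq.
  destruct (Req_dec (RInt (U (ln r)) 0 (2 * PI) - 2 * PI * Re (g p)) 0) as [|Hn]; [assumption |].
  exfalso. set (e := Rabs (RInt (U (ln r)) 0 (2 * PI) - 2 * PI * Re (g p))) in *.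
  assert (Hpos : 0 < e) by now apply Rabs_pos_lt.
  destruct (Hc (e / (4 * PI))) as [d [Hd0 Hs]]; [apply Rdiv_lt_0_compat; lra |].
  set (s := Rmin (ln r) (ln (d / 2))).
  assert (Hs1 : s <= ln r) by apply Rmin_l.
  assert (Hs2 : exp s < d).
  { apply Rle_lt_trans with (d / 2); [| lra].
    rewrite <- (exp_ln (d / 2)) by lra.
    destruct (Rmin_r (ln r) (ln (d / 2))) as [H|H]; fold s in H.
    - left; now apply exp_increasing.
    - rewrite H; lra. }
  assert (HB : Rabs (RInt (U s) 0 (2 * PI) - RInt (fun _ => 0) 0 (2 * PI) - Re (g p) * (2 * PI - 0))
     <= e / (4 * PI) * (2 * PI - 0)).
  { apply RInt_minus_const_bound; [lra | now apply HI | apply ex_RInt_const |].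
    intros t _. unfold U. rewrite Rminus_0_r. left.
    eapply Rle_lt_trans; [| apply (Hs (circle_point p (exp s) t))].
    - apply (re_le_Cmod (g (circle_point p (exp s) t) - g p)%C).
    - rewrite circle_point_mod; [exact Hs2 | left; apply exp_pos]. }
  rewrite <- (Hconst s Hs1), RInt_const in HB. unfold scal in HB; simpl in HB.
  unfold mult in HB; simpl in HB.
  replace (RInt (U (ln r)) 0 (2 * PI) - (2 * PI - 0) * 0 - Re (g p) * (2 * PI - 0))
    with (RInt (U (ln r)) 0 (2 * PI) - 2 * PI * Re (g p)) in HB by ring.
  fold e in HB.
  replace (e / (4 * PI) * (2 * PI - 0)) with (e / 2) in HB by (field; lra). lra.
Qed.

(** * The maximum principle *)

(** Bisection of the circumscribed square: near a point of the disc that is not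
    a maximum, some fixed value of [phi] dominates. *)
Lemma disc_maximum (phi : C -> R) (p : C) (r : R) : 0 <= r ->
  (forall z, Cmod (z - p)%C <= r -> forall eps, 0 < eps -> exists delta, 0 < delta /\
     forall w, Cmod (w - z)%C < delta -> phi w < phi z + eps) ->
  exists m, Cmod (m - p)%C <= r /\ forall z, Cmod (z - p)%C <= r -> phi z <= phi m.
Proof.
  intros Hr Hc. apply NNPP; intro Hno.
  assert (Hbig : forall m, Cmod (m - p)%C <= r ->
    exists z, Cmod (z - p)%C <= r /\ phi m < phi z).
  { intros m Hm. apply NNPP; intro H. apply Hno. exists m. split; [exact Hm |].
    intros z Hz. apply Rnot_lt_le. intro. apply H. now exists z. }
  set (P := fun x y h => exists m, Cmod (m - p)%C <= r /\
    forall z, Cmod (z - p)%C <= r -> x <= Re z <= x + h * (2 * r) ->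
      y <= Im z <= y + h * (2 * r) -> phi z <= phi m).
  assert (H : P (Re p - r) (Im p - r) 1).
  { apply (quarter_bisection P (2 * r) (2 * r)); [lra | lra | |].
    - intros x y h Hh (m1 & D1 & M1) (m2 & D2 & M2) (m3 & D3 & M3) (m4 & D4 & M4).
      assert (Hm : exists m, Cmod (m - p)%C <= r /\ phi m1 <= phi m /\ phi m2 <= phi m
        /\ phi m3 <= phi m /\ phi m4 <= phi m).
      { destruct (Rle_dec (phi m1) (phi m2)); destruct (Rle_dec (phi m3) (phi m4));
        [destruct (Rle_dec (phi m2) (phi m4)) | destruct (Rle_dec (phi m2) (phi m3)) |
         destruct (Rle_dec (phi m1) (phi m4)) | destruct (Rle_dec (phi m1) (phi m3))];
        [exists m4 | exists m2 | exists m3 | exists m2 | exists m4 | exists m1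
         | exists m3 | exists m1]; repeat split; lra || assumption. }
      destruct Hm as (m & Dm & L1 & L2 & L3 & L4).
      exists m. split; [exact Dm |]. intros z Dz Hx Hy.
      destruct (Rle_dec (Re z) (x + h / 2 * (2 * r)));
      destruct (Rle_dec (Im z) (y + h / 2 * (2 * r))).
      + eapply Rle_trans; [apply M1; lra || assumption | exact L1].
      + eapply Rle_trans; [apply M3; lra || assumption | exact L3].
      + eapply Rle_trans; [apply M2; lra || assumption | exact L2].
      + eapply Rle_trans; [apply M4; lra || assumption | exact L4].
    - intros a b Ha Hb.
      assert (Hball : forall (d x y h : R) z, 0 < d -> 0 < h < d / (4 * r + 1) ->
        x <= a <= x + h * (2 * r) -> y <= b <= y + h * (2 * r) ->
        x <= Re z <= x + h * (2 * r) -> y <= Im z <= y + h * (2 * r) ->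
        Cmod (z - (a, b))%C < d).
      { intros d x y h z Hd Hh Hxa Hyb Hxz Hyz.
        eapply Rle_lt_trans; [apply Cmod_2Rmax |].
        assert (Hs : sqrt 2 < 2) by apply sqrt2_lt_2.
        assert (0 <= sqrt 2) by apply sqrt_pos.
        assert (Hm : Rmax (Rabs (fst (z - (a, b))%C)) (Rabs (snd (z - (a, b))%C)) <= h * (2 * r)).
        { destruct z as [zx zy]. unfold Re, Im in *. simpl in *.
          apply Rmax_lub; apply Rabs_le; lra. }
        assert (Hlt : h * (4 * r + 1) < d).
        { replace d with (d / (4 * r + 1) * (4 * r + 1)) by (field; lra).
          apply Rmult_lt_compat_r; lra. }
        assert (0 <= h * (2 * r)) by (apply Rmult_le_pos; lra).
        apply Rle_lt_trans with (2 * (h * (2 * r))); [| lra].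
        apply Rmult_le_compat; try lra.
        eapply Rle_trans; [apply Rabs_pos | apply Rmax_l]. }
      destruct (Rle_dec (Cmod ((a, b) - p)%C) r) as [Hin|Hout].
      + destruct (Hbig _ Hin) as (m & Dm & Lm).
        destruct (Hc _ Hin (phi m - phi (a, b)) ltac:(lra)) as (d & Hd & Hsc).
        exists (d / (4 * r + 1)). split; [apply Rdiv_lt_0_compat; lra |].
        intros x y h Hh Hxa Hyb. exists m. split; [exact Dm |].
        intros z _ Hxz Hyz.
        assert (Hz := Hsc z (Hball d x y h z Hd Hh Hxa Hyb Hxz Hyz)). lra.
      + set (d := Cmod ((a, b) - p)%C - r). assert (Hd : 0 < d) by (unfold d; lra).
        exists (d / (4 * r + 1)). split; [apply Rdiv_lt_0_compat; lra |].
        intros x y h Hh Hxa Hyb. exists p.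
        split; [rewrite Cminus_diag, Cmod_0; exact Hr |].
        intros z Dz Hxz Hyz.
        assert (Hz := Hball d x y h z Hd Hh Hxa Hyb Hxz Hyz).
        assert (T := Cmod_triangle_sub (a, b) z p).
        rewrite (Cmod_minus_sym (a, b) z) in T. unfold d in Hz. lra. }
  destruct H as (m & Dm & Hm). apply Hno. exists m. split; [exact Dm |].
  intros z Dz. 
  assert (E1 := re_le_Cmod (z - p)%C).
  assert (E2 := Rmax_Cmod (z - p)%C).
  assert (E3 := Rmax_r (Rabs (fst (z - p)%C)) (Rabs (snd (z - p)%C))).
  assert (E4 := Rmax_l (Rabs (fst (z - p)%C)) (Rabs (snd (z - p)%C))).
  assert (F1 : Rabs (fst (z - p)%C) <= r) by lra.
  assert (F2 : Rabs (snd (z - p)%C) <= r) by lra.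
  apply Rabs_le_between in F1. apply Rabs_le_between in F2.
  destruct z as [zx zy]; destruct p as [px py]. unfold Re, Im in *. simpl in *.
  apply Hm; [exact Dz | unfold Re; simpl; lra | unfold Im; simpl; lra].
Qed.

Lemma list_isolated (l : list C) (z : C) (d : R) : 0 < d ->
  exists r, 0 < r < d /\ forall w, In w l -> w <> z -> r < Cmod (w - z)%C.
Proof.
  intro Hd. induction l as [|a l [r [Hr IH]]].
  - exists (d / 2). split; [lra | intros w []].
  - destruct (Ceq_dec a z) as [->|Hn].
    + exists r. split; [exact Hr |]. intros w [<-|Hw]; [congruence | now apply IH].
    + assert (Hp : 0 < Cmod (a - z)%C) by now apply Cmod_gt_0, Cminus_neq_0.
      assert (M1 := Rmin_l r (Cmod (a - z)%C / 2)).
      assert (M2 := Rmin_r r (Cmod (a - z)%C / 2)).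
      exists (Rmin r (Cmod (a - z)%C / 2)). split.
      * split; [apply Rmin_pos; lra | lra].
      * intros w [<-|Hw] Hwz; [lra |]. specialize (IH w Hw Hwz). lra.
Qed.

Lemma Cmod2_Re_sub (a b c : C) :
  Cmod (a - c)%C ^ 2 = Cmod (b - c)%C ^ 2 + 2 * Re (Cconj (b - c) * (a - b))%C + Cmod (a - b)%C ^ 2.
Proof.
  rewrite !Cmod2_alt. destruct a, b, c. unfold Re, Im. simpl. ring.
Qed.

(** Finitely many points where [g] is merely continuous are allowed, because the
    principle is meant for slopes, which are not known to be differentiable at
    their centre.

    If the bound failed inside, then [|g|^2 + e |z - p|^2] would have an interior
    maximum [c] for a small [e].  Linearising both squares at [c] gives a function
    [G] with [G c = 0], differentiable near [c] except possibly at [c], with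
    negative real part bounded away from [0] on a small circle about [c]; this
    contradicts the mean value property. *)
Lemma maximum_principle (g : C -> C) (p : C) (r M : R) (l : list C) : 0 < r ->
  (forall z, Cmod (z - p)%C <= r -> ccont g z) ->
  (forall z, Cmod (z - p)%C < r -> ~ In z l -> exists L, cdiff g z L) ->
  (forall z, Cmod (z - p)%C = r -> Cmod (g z) <= M) ->
  forall z, Cmod (z - p)%C <= r -> Cmod (g z) <= M.
Proof.
  intros Hr Hc Hd HM z1 Hz1. apply Rnot_lt_le. intro Hbig.
  assert (HM0 : 0 <= M).
  { eapply Rle_trans; [apply Cmod_ge_0 | apply (HM (circle_point p r 0))].
    apply circle_point_mod; lra. }
  (* Small enough for the penalty e r^2 not to bring the boundary values of phi
     above its value at z1. *)
  set (e := (Cmod (g z1) ^ 2 - M ^ 2) / (2 * r ^ 2)).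
  assert (He : 0 < e).
  { apply Rdiv_lt_0_compat; [nra |]. assert (0 < r ^ 2) by (apply pow_lt; lra). lra. }
  assert (Her : 2 * (e * r ^ 2) = Cmod (g z1) ^ 2 - M ^ 2) by (unfold e; field; lra).
  set (phi := fun z => Cmod (g z) ^ 2 + e * Cmod (z - p)%C ^ 2).
  destruct (disc_maximum phi p r) as (c & Dc & Mc); [lra | |].
  { intros z Dz eps Heps.
    (* phi is the real part of a sum of products of continuous functions. *)
    set (q := fun w => (Cconj (g w) * g w + RtoC e * (Cconj (w - p) * (w - p)))%C).
    assert (Eq : forall w, phi w = Re (q w)).
    { intro w. unfold phi, q. rewrite !Cmod2_alt. destruct (g w), w, p.
      unfold Re, Im. simpl. ring. }
    assert (Hconj : forall f, ccont f z -> ccont (fun w => Cconj (f w)) z).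
    { intros f Hf e' He'. destruct (Hf e' He') as [d [Hd' Hs]]. exists d.
      split; [exact Hd' |]. intros w Hw. rewrite <- Cminus_conj, Cmod_conj. now apply Hs. }
    assert (Hlin : ccont (fun w => w - p)%C z)
      by (apply ccont_minus; [apply ccont_id | apply ccont_const]).
    assert (Hq : ccont q z).
    { apply ccont_plus; apply ccont_mult; auto.
      - apply ccont_const.
      - apply ccont_mult; auto. }
    destruct (Hq eps Heps) as [d [Hd' Hs]]. exists d. split; [exact Hd' |].
    intros w Hw. rewrite !Eq. specialize (Hs w Hw).
    assert (T := re_le_Cmod (q w - q z)%C).
    assert (T2 := Rle_abs (Re (q w - q z)%C)).
    change (Re (q w - q z)%C) with (Re (q w) - Re (q z)) in *. lra. }
  assert (Hcr : Cmod (c - p)%C < r).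
  { destruct Dc as [|Dc]; [assumption | exfalso].
    assert (H1 := Mc z1 Hz1). unfold phi in H1. rewrite Dc in H1.
    assert (H2 := HM c Dc). assert (H3 := Cmod_ge_0 (g c)).
    assert (0 <= e * Cmod (z1 - p)%C ^ 2)
      by (apply Rmult_le_pos; [lra | apply pow2_ge_0]).
    assert (Cmod (g c) ^ 2 <= M ^ 2) by (apply pow_incr; lra). nra. }
  destruct (list_isolated l c (r - Cmod (c - p)%C)) as (rho & Hrho & Hiso); [lra |].
  assert (Hin : forall z, Cmod (z - c)%C <= rho -> Cmod (z - p)%C < r).
  { intros z Hz. assert (T := Cmod_triangle_sub z c p). lra. }
  set (G := fun z => (2 * Cconj (g c) * (g z - g c) + 2 * e * Cconj (c - p) * (z - c))%C).
  destruct (mean_value_circle G c rho) as [HI HE]; [lra | | |].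
  - apply ccont_plus; apply ccont_mult; try apply ccont_const;
      apply ccont_minus; try apply ccont_const; try apply ccont_id.
    apply Hc. lra.
  - intros z Hz. destruct (Hd z) as [L HL]; [apply Hin; lra | |].
    + intro Hl. assert (z <> c).
      { intros ->. rewrite Cminus_diag, Cmod_0 in Hz. lra. }
      specialize (Hiso z Hl H). lra.
    + eexists. apply cdiff_plus; apply cdiff_mult; try apply cdiff_const;
        apply cdiff_minus; try apply cdiff_const; try apply cdiff_id. exact HL.
  - assert (HG : forall t, Re (G (circle_point c rho t)) <= - (e * rho ^ 2)).
    { intro t. set (z := circle_point c rho t).
      assert (Ez : Cmod (z - c)%C = rho) by (apply circle_point_mod; lra).
      assert (H1 := Mc z ltac:(left; apply Hin; lra)). unfold phi in H1.
      assert (E1 := Cmod2_Re_sub (g z) (g c) 0).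
      assert (E2 := Cmod2_Re_sub z c p). rewrite Ez in E2.
      replace (g z - 0)%C with (g z) in E1 by ring.
      replace (g c - 0)%C with (g c) in E1 by ring.
      assert (0 <= Cmod (g z - g c)%C ^ 2) by apply pow2_ge_0.
      assert (EG : Re (G z) = 2 * Re (Cconj (g c) * (g z - g c))%C
         + e * (2 * Re (Cconj (c - p) * (z - c))%C)).
      { unfold G. destruct (g z), (g c), z, c, p. unfold Re, Im. simpl. ring. }
      rewrite EG. nra. }
    assert (HPI := PI_RGT_0).
    assert (HL := RInt_le _ (fun _ => - (e * rho ^ 2)) 0 (2 * PI) ltac:(lra) HI
      ltac:(apply ex_RInt_const) (fun t _ => HG t)).
    rewrite HE, RInt_const in HL. unfold scal in HL; simpl in HL.
    unfold mult in HL; simpl in HL.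
    replace (Re (G c)) with 0 in HL.
    + assert (0 < e * (rho * rho)) by (apply Rmult_lt_0_compat; nra). nra.
    + unfold G. rewrite !Cminus_diag, !Cmult_0_r, Cplus_0_r. reflexivity.
Qed.

(** * Uniform limits *)

Definition ccvg (u : nat -> C) (l : C) : Prop :=
  forall eps, 0 < eps -> exists N, forall n, (N <= n)%nat -> Cmod (u n - l)%C < eps.

Lemma Cmod_le_Re_Im (z : C) : Cmod z <= Rabs (Re z) + Rabs (Im z).
Proof.
  apply Rsqr_incr_0_var.
  - unfold Rsqr. assert (H := Cmod2_alt z).
    assert (H1 := Rabs_pos (Re z)). assert (H2 := Rabs_pos (Im z)).
    assert (E1 := pow2_abs (Re z)). assert (E2 := pow2_abs (Im z)). nra.
  - assert (H1 := Rabs_pos (Re z)). assert (H2 := Rabs_pos (Im z)). lra.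
Qed.

Lemma ccvg_of_cauchy (u : nat -> C) :
  (forall eps, 0 < eps -> exists N, forall n m, (N <= n)%nat -> (N <= m)%nat ->
     Cmod (u n - u m)%C < eps) -> exists l, ccvg u l.
Proof.
  intro H.
  assert (HR : ex_finite_lim_seq (fun n => Re (u n))).
  { apply ex_lim_seq_cauchy_corr. intro eps. destruct (H eps (cond_pos eps)) as [N HN].
    exists N. intros n m Hn Hm. eapply Rle_lt_trans; [| apply (HN n m Hn Hm)].
    apply (re_le_Cmod (u n - u m)%C). }
  assert (HI : ex_finite_lim_seq (fun n => Im (u n))).
  { apply ex_lim_seq_cauchy_corr. intro eps. destruct (H eps (cond_pos eps)) as [N HN].
    exists N. intros n m Hn Hm. eapply Rle_lt_trans; [| apply (HN n m Hn Hm)].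
    apply (im_le_Cmod (u n - u m)%C). }
  destruct HR as [a Ha], HI as [b Hb].
  apply is_lim_seq_spec in Ha. apply is_lim_seq_spec in Hb. simpl in Ha, Hb.
  exists (a, b). intros eps He.
  assert (He2 : 0 < eps / 2) by lra.
  destruct (Ha (mkposreal _ He2)) as [N1 H1]. destruct (Hb (mkposreal _ He2)) as [N2 H2].
  simpl in H1, H2. exists (max N1 N2). intros n Hn.
  specialize (H1 n ltac:(lia)). specialize (H2 n ltac:(lia)).
  eapply Rle_lt_trans; [apply Cmod_le_Re_Im |].
  change (Re (u n - (a, b))%C) with (Re (u n) - a).
  change (Im (u n - (a, b))%C) with (Im (u n) - b). lra.
Qed.

Lemma ccvg_Cmod_sub_le (u : nat -> C) l a e N : ccvg u l ->
  (forall n, (N <= n)%nat -> Cmod (a - u n)%C <= e) -> Cmod (a - l)%C <= e.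
Proof.
  intros Hu H. apply le_epsilon. intros eps He.
  destruct (Hu eps He) as [N' HN']. set (n := max N N').
  assert (T := Cmod_triangle_sub a (u n) l).
  specialize (H n ltac:(unfold n; lia)). specialize (HN' n ltac:(unfold n; lia)). lra.
Qed.

(** The slopes [S n] of [g n] at [p] differ little on the boundary circle when the
    [g n] are close to each other, hence on the whole disc by the maximum principle.
    So they converge uniformly, including at [p], and the slope of the limit is
    continuous at [p]. *)
Lemma weierstrass_differentiable (g : nat -> C -> C) (h : C -> C) (p : C) (r : R) : 0 < r ->
  (forall n z, Cmod (z - p)%C <= r -> exists L, cdiff (g n) z L) ->
  (forall eps, 0 < eps -> exists N, forall n, (N <= n)%nat ->
     forall z, Cmod (z - p)%C <= r -> Cmod (g n z - h z)%C < eps) ->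
  exists L, cdiff h p L.
Proof.
  intros Hr Hg Hunif.
  assert (Hpp : Cmod (p - p)%C <= r) by (rewrite Cminus_diag, Cmod_0; lra).
  destruct (functional_choice _ (fun n => Hg n p Hpp)) as [L HL].
  set (S := fun n => slope (g n) p (L n)).
  assert (HS : forall eps, 0 < eps -> exists N, forall n m, (N <= n)%nat -> (N <= m)%nat ->
    forall z, Cmod (z - p)%C <= r -> Cmod (S n z - S m z)%C <= eps).
  { intros eps He.
    destruct (Hunif (eps * r / 4)) as [N HN].
    { apply Rdiv_lt_0_compat; [apply Rmult_lt_0_compat; lra | lra]. }
    exists N. intros n m Hn Hm.
    assert (HSd : forall k z, Cmod (z - p)%C <= r -> z <> p -> exists M, cdiff (S k) z M).
    { intros k z Hz Hzp. destruct (Hg k z Hz) as [M HM]. eapply cdiff_slope; eassumption. }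
    assert (HSc : forall k z, Cmod (z - p)%C <= r -> ccont (S k) z).
    { intros k z Hz. destruct (Ceq_dec z p) as [->|Hzp]; [apply HL |].
      destruct (HSd k z Hz Hzp) as [M HM]. eapply cdiff_ccont; exact HM. }
    apply (maximum_principle (fun z => S n z - S m z)%C p r eps (p :: nil)); [lra | | |].
    - intros z Hz. apply ccont_minus; auto.
    - intros z Hz Hin.
      assert (Hzp : z <> p) by (intros ->; apply Hin; now left).
      destruct (HSd n z ltac:(lra) Hzp) as [M1 H1].
      destruct (HSd m z ltac:(lra) Hzp) as [M2 H2].
      exists (M1 - M2)%C. now apply cdiff_minus.
    - intros z Hz.
      apply Rmult_le_reg_r with r; [lra |].
      rewrite <- Hz at 1. rewrite <- Cmod_mult.
      replace ((S n z - S m z) * (z - p))%C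
        with (((g n z - h z) - (g m z - h z)) - ((g n p - h p) - (g m p - h p)))%C.
      2:{ transitivity ((g n z - g n p) - (g m z - g m p))%C; [ring |].
          rewrite (slope_spec (g n) p (L n)), (slope_spec (g m) p (L m)).
          unfold S. ring. }
      assert (B1 := HN n Hn z ltac:(lra)). assert (B2 := HN m Hm z ltac:(lra)).
      assert (B3 := HN n Hn p Hpp). assert (B4 := HN m Hm p Hpp).
      assert (T : forall a b : C, Cmod (a - b)%C <= Cmod a + Cmod b).
      { intros a b. replace (a - b)%C with (a + - b)%C by ring.
        rewrite <- (Cmod_opp b). apply Cmod_triangle. }
      eapply Rle_trans; [apply T |].
      assert (T1 := T (g n z - h z)%C (g m z - h z)%C).
      assert (T2 := T (g n p - h p)%C (g m p - h p)%C). lra. }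
  destruct (ccvg_of_cauchy L) as [l Hl].
  { intros eps He. destruct (HS (eps / 2)) as [N HN]; [lra |]. exists N.
    intros n m Hn Hm. specialize (HN n m Hn Hm p Hpp).
    unfold S in HN. rewrite !slope_diag in HN. lra. }
  assert (HSl : forall z, Cmod (z - p)%C <= r -> ccvg (fun n => S n z) (slope h p l z)).
  { intros z Hz. unfold S, slope. destruct (Ceq_dec z p) as [_|Hn]; [exact Hl |].
    intros eps He.
    assert (Hp : 0 < Cmod (z - p)%C) by now apply Cmod_gt_0, Cminus_neq_0.
    destruct (Hunif (eps / 2 * Cmod (z - p)%C)) as [N HN].
    { apply Rmult_lt_0_compat; lra. }
    exists N. intros n Hn'.
    replace ((g n z - g n p) / (z - p) - (h z - h p) / (z - p))%C
      with (((g n z - h z) - (g n p - h p)) / (z - p))%C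
      by (field; now apply Cminus_neq_0).
    rewrite Cmod_div by now apply Cminus_neq_0.
    apply Rmult_lt_reg_r with (Cmod (z - p)%C); [exact Hp |].
    unfold Rdiv. rewrite Rmult_assoc, Rinv_l, Rmult_1_r by lra.
    assert (B1 := HN n Hn' z Hz). assert (B2 := HN n Hn' p Hpp).
    assert (T := Cmod_triangle (g n z - h z)%C (- (g n p - h p))%C).
    rewrite Cmod_opp in T. unfold Cminus at 1. lra. }
  exists l. intros eps He.
  destruct (HS (eps / 3)) as [N HN]; [lra |].
  assert (HNl : forall z, Cmod (z - p)%C <= r -> Cmod (S N z - slope h p l z)%C <= eps / 3).
  { intros z Hz. apply (ccvg_Cmod_sub_le (fun n => S n z) _ _ _ N); [now apply HSl |].
    intros n Hn. now apply HN. }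
  destruct (HL N (eps / 3)) as [d [Hd Hs]]; [lra |].
  exists (Rmin r d). split; [now apply Rmin_pos |]. intros w Hw.
  assert (M1 := Rmin_l r d). assert (M2 := Rmin_r r d).
  specialize (Hs w ltac:(lra)). fold (S N) in Hs.
  assert (B1 := HNl w ltac:(lra)). assert (B2 := HNl p Hpp).
  rewrite Cmod_minus_sym in B1.
  assert (T1 := Cmod_triangle_sub (slope h p l w) (S N w) (slope h p l p)).
  assert (T2 := Cmod_triangle_sub (S N w) (S N p) (slope h p l p)). lra.
Qed.

(** * The lemmas of Schwarz and Schwarz-Pick *)

(** The automorphism of the disc that moves [a] to [0]; its inverse is
    [mob (- a)]. *)
Definition mob (a z : C) : C := ((z - a) / (1 - Cconj a * z))%C.

(** The pseudo-hyperbolic distance, whose [artanh] is the Poincare distance. *)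
Definition pseudohyp (z w : C) : R := Cmod (mob z w).

Lemma mob_denom_neq_0 a z : unit_disc a -> unit_disc z -> (1 - Cconj a * z)%C <> 0.
Proof.
  unfold unit_disc. intros Ha Hz E.
  assert (H : Cmod (Cconj a * z)%C = 1).
  { replace (Cconj a * z)%C with (1 - (1 - Cconj a * z))%C by ring. rewrite E.
    replace (1 - 0)%C with (RtoC 1) by ring. apply Cmod_1. }
  rewrite Cmod_mult, Cmod_conj in H.
  assert (H1 := Cmod_ge_0 a). assert (H2 := Cmod_ge_0 z). nra.
Qed.

Lemma mob_denom_le_2 a z : unit_disc a -> unit_disc z -> Cmod (1 - Cconj a * z)%C <= 2.
Proof.
  unfold unit_disc. intros Ha Hz.
  assert (T := Cmod_triangle 1 (- (Cconj a * z))%C).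
  rewrite Cmod_opp, Cmod_mult, Cmod_conj, Cmod_1 in T.
  assert (H1 := Cmod_ge_0 a). assert (H2 := Cmod_ge_0 z).
  unfold Cminus. nra.
Qed.

Lemma mob_modulus_identity (a z : C) :
  Cmod (1 - Cconj a * z)%C ^ 2 - Cmod (z - a)%C ^ 2 = (1 - Cmod a ^ 2) * (1 - Cmod z ^ 2).
Proof.
  rewrite !Cmod2_alt. destruct a, z. unfold Re, Im. simpl. ring.
Qed.

Lemma pseudohyp_mult_denom a z : unit_disc a -> unit_disc z ->
  pseudohyp a z * Cmod (1 - Cconj a * z)%C = Cmod (z - a)%C.
Proof.
  intros Ha Hz. unfold pseudohyp, mob. rewrite <- Cmod_mult. f_equal.
  field. now apply mob_denom_neq_0.
Qed.

Lemma one_sub_pseudohyp_sq a z : unit_disc a -> unit_disc z ->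
  (1 - pseudohyp a z ^ 2) * Cmod (1 - Cconj a * z)%C ^ 2 = (1 - Cmod a ^ 2) * (1 - Cmod z ^ 2).
Proof.
  intros Ha Hz. rewrite <- mob_modulus_identity, <- (pseudohyp_mult_denom a z Ha Hz). ring.
Qed.

Lemma pseudohyp_ge_0 a z : 0 <= pseudohyp a z.
Proof. apply Cmod_ge_0. Qed.

Lemma pseudohyp_lt_1 a z : unit_disc a -> unit_disc z -> pseudohyp a z < 1.
Proof.
  intros Ha Hz. assert (H := one_sub_pseudohyp_sq a z Ha Hz).
  assert (H1 := pseudohyp_ge_0 a z).
  assert (H2 := Cmod_ge_0 a). assert (H3 := Cmod_ge_0 z).
  unfold unit_disc in *.
  assert (0 < (1 - Cmod a ^ 2) * (1 - Cmod z ^ 2)) by (apply Rmult_lt_0_compat; nra).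
  apply Rnot_le_lt. intro. 
  assert (0 <= (pseudohyp a z ^ 2 - 1) * Cmod (1 - Cconj a * z)%C ^ 2); [| lra].
  apply Rmult_le_pos; [nra | apply pow2_ge_0].
Qed.

Lemma mob_disc a z : unit_disc a -> unit_disc z -> unit_disc (mob a z).
Proof. apply pseudohyp_lt_1. Qed.

Lemma opp_disc a : unit_disc a -> unit_disc (- a)%C.
Proof. unfold unit_disc. now rewrite Cmod_opp. Qed.

Lemma zero_disc : unit_disc 0.
Proof. unfold unit_disc. rewrite Cmod_0. apply Rlt_0_1. Qed.

Lemma mob_0 a : mob a a = 0.
Proof. unfold mob. rewrite Cminus_diag. apply Cmult_0_l. Qed.

Lemma mob_opp_0 a : mob (- a) 0 = a.
Proof.
  unfold mob. rewrite Cmult_0_r. replace (1 - 0)%C with (RtoC 1) by ring. field.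
Qed.

Lemma mob_opp_mob a z : unit_disc a -> unit_disc z -> mob (- a) (mob a z) = z.
Proof.
  intros Ha Hz. assert (H := mob_denom_neq_0 a z Ha Hz).
  assert (Haa := mob_denom_neq_0 a a Ha Ha).
  unfold mob. rewrite Copp_conj. field. split; [exact H |].
  intro E. apply Haa. rewrite <- E. ring.
Qed.

Lemma mob_mob_opp a z : unit_disc a -> unit_disc z -> mob a (mob (- a) z) = z.
Proof.
  intros Ha Hz. rewrite <- (mob_opp_mob (- a) z (opp_disc a Ha) Hz) at 2.
  f_equal. ring.
Qed.

Lemma cdiff_mob a z : unit_disc a -> unit_disc z -> exists L, cdiff (mob a) z L.
Proof.
  intros Ha Hz. eexists. unfold mob, Cdiv. apply cdiff_mult.
  - apply cdiff_minus; [apply cdiff_id | apply cdiff_const].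
  - apply cdiff_inv; [now apply mob_denom_neq_0 |].
    apply cdiff_minus; [apply cdiff_const |].
    apply cdiff_mult; [apply cdiff_const | apply cdiff_id].
Qed.

Lemma ccont_mob a z : unit_disc a -> unit_disc z -> ccont (mob a) z.
Proof.
  intros Ha Hz. destruct (cdiff_mob a z Ha Hz) as [L HL]. eapply cdiff_ccont; exact HL.
Qed.

Definition bounded_holomorphic_off (l : list C) (g : C -> C) : Prop :=
  (forall z, unit_disc z -> ccont g z) /\
  (forall z, unit_disc z -> ~ In z l -> exists L, cdiff g z L) /\
  (forall z, unit_disc z -> Cmod (g z) <= 1).

(** Schwarz's lemma in the form that keeps the slope in the class: on the circle
    of radius [s] the slope has modulus at most [1 / s], and [s] tends to [1]. *)
Lemma slope_bounded_holomorphic_off l g L : bounded_holomorphic_off l g ->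
  cdiff g 0 L -> g 0 = 0 -> bounded_holomorphic_off (RtoC 0 :: l) (slope g 0 L).
Proof.
  intros (Hc & Hd & Hb) HL H0.
  assert (HSc : forall z, unit_disc z -> ccont (slope g 0 L) z).
  { intros z Hz. destruct (Ceq_dec z 0) as [->|Hn]; [exact HL |].
    apply (ccont_ext_loc (fun v => (g v - g 0) * / (v - 0))%C _ z (Cmod (z - 0)%C)).
    - now apply Cmod_gt_0, Cminus_neq_0.
    - intros v Hv. unfold slope. destruct (Ceq_dec v 0) as [->|]; [| reflexivity].
      rewrite Cmod_minus_sym in Hv. lra.
    - apply ccont_mult; [apply ccont_minus; [now apply Hc | apply ccont_const] |].
      apply ccont_inv; [now apply Cminus_neq_0 |].
      apply ccont_minus; [apply ccont_id | apply ccont_const]. }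
  assert (HSd : forall z, unit_disc z -> ~ In z (RtoC 0 :: l) ->
    exists M, cdiff (slope g 0 L) z M).
  { intros z Hz Hin. destruct (Hd z Hz) as [M HM]; [intro; apply Hin; now right |].
    apply (cdiff_slope g 0 L z M); [| exact HM].
    intros ->. apply Hin. now left. }
  split; [exact HSc | split; [exact HSd |]].
  intros z Hz. apply Rnot_lt_le. intro Hgt. unfold unit_disc in Hz.
  set (b := Cmod (slope g 0 L z)) in *.
  assert (Hb1 : / b < 1) by (rewrite <- Rinv_1; apply Rinv_lt_contravar; lra).
  assert (Hb0 : 0 < / b) by (apply Rinv_0_lt_compat; lra).
  (* A radius s < 1 beyond z with 1 / s < b. *)
  set (s := (1 + Rmax (Cmod z) (/ b)) / 2).
  assert (M1 := Rmax_l (Cmod z) (/ b)). assert (M2 := Rmax_r (Cmod z) (/ b)).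
  assert (M3 : Rmax (Cmod z) (/ b) < 1) by now apply Rmax_lub_lt.
  assert (Hs : Cmod z < s /\ / b < s /\ s < 1) by (unfold s; lra).
  assert (Hsub0 : forall w : C, (w - 0)%C = w) by (intro; ring).
  assert (HH : b <= / s).
  { apply (maximum_principle (slope g 0 L) 0 s (/ s) (RtoC 0 :: l)); [lra | | | |].
    - intros w Hw. rewrite Hsub0 in Hw. apply HSc. unfold unit_disc. lra.
    - intros w Hw. rewrite Hsub0 in Hw. apply HSd. unfold unit_disc. lra.
    - intros w Hw. rewrite Hsub0 in Hw.
      apply Rmult_le_reg_r with s; [lra |]. rewrite Rinv_l by lra.
      rewrite <- Hw at 1. rewrite <- Cmod_mult.
      replace (slope g 0 L w * w)%C with (g w).
      + apply Hb. unfold unit_disc. lra.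
      + rewrite <- (Hsub0 (g w)), <- H0 at 1. rewrite (slope_spec g 0 L), Hsub0. reflexivity.
    - rewrite Hsub0. lra. }
  assert (/ s < / / b).
  { apply Rinv_lt_contravar; [| lra]. apply Rmult_lt_0_compat; lra. }
  rewrite Rinv_inv in H. lra.
Qed.

Lemma schwarz l g L : bounded_holomorphic_off l g -> cdiff g 0 L -> g 0 = 0 ->
  forall z, unit_disc z -> Cmod (g z) <= Cmod z.
Proof.
  intros Hg HL H0 z Hz.
  destruct (slope_bounded_holomorphic_off l g L Hg HL H0) as (_ & _ & Hb).
  replace (g z) with (slope g 0 L z * z)%C.
  - rewrite Cmod_mult. specialize (Hb z Hz). assert (H := Cmod_ge_0 z). nra.
  - replace (g z) with (g z - g 0)%C by (rewrite H0; ring).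
    rewrite (slope_spec g 0 L). ring.
Qed.

(** Schwarz's lemma for [q] conjugated by automorphisms that move [a] and [q a]
    to [0].  The inequality is stated without quotients because [q] may take
    values on the unit circle; it is first proved for [t q] with [t < 1], whose
    values lie in the open disc. *)
Lemma schwarz_pick l q a : bounded_holomorphic_off l q -> unit_disc a -> ~ In a l ->
  forall z, unit_disc z ->
  Cmod (q z - q a)%C * Cmod (1 - Cconj a * z)%C
    <= Cmod (z - a)%C * Cmod (1 - Cconj (q a) * q z)%C.
Proof.
  intros (Hc & Hd & Hb) Ha Hal z Hz.
  set (X := (Cconj (q a) * q z)%C).
  assert (HX : Cmod X <= 1).
  { unfold X. rewrite Cmod_mult, Cmod_conj.
    assert (B1 := Hb a Ha). assert (B2 := Hb z Hz).
    assert (B3 := Cmod_ge_0 (q a)). assert (B4 := Cmod_ge_0 (q z)). nra. }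
  assert (Ht : forall t, 0 < t < 1 ->
    t * (Cmod (q z - q a)%C * Cmod (1 - Cconj a * z)%C)
    <= Cmod (z - a)%C * Cmod (1 - X)%C + Cmod (z - a)%C * (1 - t ^ 2)).
  { intros t Ht.
    assert (Hopa := opp_disc a Ha).
    assert (Htq : forall w, unit_disc w -> unit_disc (RtoC t * q w)%C).
    { intros w Hw. unfold unit_disc. rewrite Cmod_mult, Cmod_R, Rabs_right by lra.
      assert (B := Hb w Hw). assert (B' := Cmod_ge_0 (q w)). nra. }
    set (g := fun w => mob (RtoC t * q a) (RtoC t * q (mob (- a) w))).
    assert (Hgd : forall w, unit_disc w -> ~ In (mob (- a) w) l -> exists M, cdiff g w M).
    { intros w Hw Hin. assert (Hmw := mob_disc _ _ Hopa Hw).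
      destruct (Hd (mob (- a) w) Hmw Hin) as [M HM].
      destruct (cdiff_mob (- a) w Hopa Hw) as [M1 HM1].
      destruct (cdiff_mob (RtoC t * q a) (RtoC t * q (mob (- a) w)) (Htq a Ha) (Htq _ Hmw))
        as [M2 HM2].
      eexists. apply (cdiff_comp (mob (RtoC t * q a)) (fun w => RtoC t * q (mob (- a) w))%C);
        [| exact HM2].
      apply cdiff_mult; [apply cdiff_const |]. apply (cdiff_comp q); eassumption. }
    assert (Hg : bounded_holomorphic_off (map (mob a) l) g).
    { split; [| split].
      - intros w Hw. assert (Hmw := mob_disc _ _ Hopa Hw).
        apply (ccont_comp (mob (RtoC t * q a)) (fun w => RtoC t * q (mob (- a) w))%C).
        + apply ccont_mult; [apply ccont_const |].
          apply (ccont_comp q); [now apply ccont_mob | now apply Hc].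
        + now apply ccont_mob; apply Htq.
      - intros w Hw Hin. apply Hgd; [exact Hw |].
        intro H. apply Hin. rewrite <- (mob_mob_opp a w Ha Hw). now apply in_map.
      - intros w Hw. left. apply mob_disc; apply Htq; [exact Ha | now apply mob_disc]. }
    destruct (Hgd 0) as [M HM]; [apply zero_disc | now rewrite mob_opp_0 |].
    assert (Hg0 : g 0 = 0) by (unfold g; rewrite mob_opp_0; apply mob_0).
    assert (Hs := schwarz _ g M Hg HM Hg0 (mob a z) (mob_disc a z Ha Hz)).
    unfold g in Hs. rewrite mob_opp_mob in Hs by assumption.
    assert (E1 := pseudohyp_mult_denom _ _ (Htq a Ha) (Htq z Hz)).
    assert (E2 := pseudohyp_mult_denom a z Ha Hz).
    change (pseudohyp (t * q a) (t * q z) <= pseudohyp a z) in Hs.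
    replace (RtoC t * q z - RtoC t * q a)%C with (RtoC t * (q z - q a))%C in E1 by ring.
    rewrite Cmod_mult, Cmod_R, Rabs_right in E1 by lra.
    rewrite Cmult_conj in E1.
    replace (1 - Cconj (RtoC t) * Cconj (q a) * (RtoC t * q z))%C
      with ((1 - X) + RtoC (1 - t ^ 2) * X)%C in E1.
    2:{ unfold X. rewrite RtoC_minus, RtoC_pow. 
        replace (Cconj (RtoC t)) with (RtoC t) by (unfold Cconj, RtoC; simpl; f_equal; ring).
        simpl. ring. }
    assert (T := Cmod_triangle (1 - X)%C (RtoC (1 - t ^ 2) * X)%C).
    rewrite Cmod_mult, Cmod_R, Rabs_right in T by nra.
    assert (P1 := Cmod_ge_0 (1 - Cconj a * z)%C).
    assert (P2 := pseudohyp_ge_0 a z). assert (P3 := pseudohyp_ge_0 (t * q a) (t * q z)).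
    set (Y := Cmod (1 - X + RtoC (1 - t ^ 2) * X)%C) in *.
    assert (HY : Y <= Cmod (1 - X)%C + (1 - t ^ 2)).
    { assert (0 <= (1 - t ^ 2) * (1 - Cmod X)) by (apply Rmult_le_pos; nra). lra. }
    assert (HY0 : 0 <= Y) by apply Cmod_ge_0.
    rewrite <- Rmult_assoc, <- E1, <- E2.
    assert (F1 : pseudohyp (t * q a) (t * q z) * Y <= pseudohyp a z * (Cmod (1 - X)%C + (1 - t ^ 2)))
      by (apply Rmult_le_compat; assumption).
    assert (F2 := Rmult_le_compat_r _ _ _ P1 F1). lra. }
  set (A := Cmod (q z - q a)%C * Cmod (1 - Cconj a * z)%C) in *.
  set (D := Cmod (z - a)%C * Cmod (1 - X)%C) in *.
  assert (HB := Cmod_ge_0 (z - a)%C). set (B := Cmod (z - a)%C) in *.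
  assert (HA : 0 <= A) by (apply Rmult_le_pos; apply Cmod_ge_0).
  apply Rnot_lt_le. intro Hlt.
  set (K := 2 * (A + 2 * B + 1)).
  assert (HK : 0 < K) by (unfold K; lra).
  set (e := Rmin (1 / 2) ((A - D) / K)).
  assert (He0 : 0 < e) by (apply Rmin_pos; [lra | apply Rdiv_lt_0_compat; lra]).
  assert (He1 : e <= 1 / 2) by apply Rmin_l.
  assert (He2 : e * K <= A - D).
  { replace (A - D) with ((A - D) / K * K) by (field; lra).
    apply Rmult_le_compat_r; [lra | apply Rmin_r]. }
  specialize (Ht (1 - e) ltac:(lra)). unfold K in He2. nra.
Qed.

Lemma holomorphic_cdiff f z : holomorphic_self_map f -> unit_disc z -> exists L, cdiff f z L.
Proof.
  intros [_ H] Hz. destruct (H z Hz) as [L HL]. exists L. now apply cdiff_is_derive.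
Qed.

Lemma holomorphic_of_cdiff f : (forall z, unit_disc z -> unit_disc (f z)) ->
  (forall z, unit_disc z -> exists L, cdiff f z L) -> holomorphic_self_map f.
Proof.
  intros H1 H2. split; [exact H1 |]. intros z Hz. destruct (H2 z Hz) as [L HL].
  exists L. now apply cdiff_is_derive.
Qed.

Lemma holomorphic_bounded_off f : holomorphic_self_map f -> bounded_holomorphic_off nil f.
Proof.
  intros Hf. split; [| split].
  - intros z Hz. destruct (holomorphic_cdiff f z Hf Hz) as [L HL].
    eapply cdiff_ccont; exact HL.
  - intros z Hz _. now apply holomorphic_cdiff.
  - intros z Hz. left. now apply Hf.
Qed.

Lemma holomorphic_comp f g : holomorphic_self_map f -> holomorphic_self_map g ->
  holomorphic_self_map (fun z => f (g z)).
Proof.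
  intros Hf Hg. apply holomorphic_of_cdiff.
  - intros z Hz. now apply Hf, Hg.
  - intros z Hz. destruct (holomorphic_cdiff g z Hg Hz) as [M HM].
    destruct (holomorphic_cdiff f (g z) Hf (proj1 Hg z Hz)) as [L HL].
    eexists. apply (cdiff_comp f g); eassumption.
Qed.

Lemma holomorphic_iterate f n : holomorphic_self_map f -> holomorphic_self_map (iterate f n).
Proof.
  intro Hf. induction n as [|n IH].
  - apply holomorphic_of_cdiff; [intros z Hz; exact Hz |].
    intros z _. exists (RtoC 1). apply cdiff_id.
  - apply (holomorphic_comp f (iterate f n)); assumption.
Qed.

Lemma holomorphic_mob a : unit_disc a -> holomorphic_self_map (mob a).
Proof.
  intro Ha. apply holomorphic_of_cdiff; intros; [now apply mob_disc | now apply cdiff_mob].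
Qed.

Lemma pseudohyp_contraction f a z : holomorphic_self_map f -> unit_disc a -> unit_disc z ->
  pseudohyp (f a) (f z) <= pseudohyp a z.
Proof.
  intros Hf Ha Hz.
  assert (H := schwarz_pick nil f a (holomorphic_bounded_off f Hf) Ha (fun H => H) z Hz).
  assert (Hfa := proj1 Hf a Ha). assert (Hfz := proj1 Hf z Hz).
  rewrite <- (pseudohyp_mult_denom a z Ha Hz), <- (pseudohyp_mult_denom _ _ Hfa Hfz) in H.
  assert (P1 : 0 < Cmod (1 - Cconj a * z)%C) by now apply Cmod_gt_0, mob_denom_neq_0.
  assert (P2 : 0 < Cmod (1 - Cconj (f a) * f z)%C) by now apply Cmod_gt_0, mob_denom_neq_0.
  apply Rmult_le_reg_r with (Cmod (1 - Cconj a * z)%C * Cmod (1 - Cconj (f a) * f z)%C).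
  - now apply Rmult_lt_0_compat.
  - lra.
Qed.

(** The slope [q z = H z / z] is bounded by [1] by Schwarz's lemma.  When
    [|q a|] is close to [1], Schwarz-Pick applied to [q] forces [q] to be nearly
    constant on every pseudo-hyperbolic disc about [a]: [H] is nearly a rotation
    there. *)
Lemma schwarz_rigidity (H : C -> C) (a z : C) (r : R) : holomorphic_self_map H -> H 0 = 0 ->
  unit_disc a -> a <> 0 -> unit_disc z -> pseudohyp a z <= r -> r < 1 ->
  Cmod (H z - H a / a * z)%C <= Cmod z * (r * (1 - Cmod (H a / a)%C ^ 2) / (1 - r)).
Proof.
  intros HH H0 Ha Ha0 Hz Hr Hr1.
  assert (HB := holomorphic_bounded_off H HH).
  destruct (holomorphic_cdiff H 0 HH zero_disc) as [L HL].
  assert (Hq := slope_bounded_holomorphic_off nil H L HB HL H0).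
  set (q := slope H 0 L) in *.
  assert (Eq : forall w, (H w = q w * w)%C).
  { intro w. replace (H w) with (H w - H 0)%C by (rewrite H0; ring).
    rewrite (slope_spec H 0 L). unfold q. ring. }
  assert (Ek : (H a / a)%C = q a) by (rewrite Eq; now field).
  rewrite Ek, Eq.
  replace (q z * z - q a * z)%C with (z * (q z - q a))%C by ring. rewrite Cmod_mult.
  apply Rmult_le_compat_l; [apply Cmod_ge_0 |].
  assert (S := schwarz_pick _ q a Hq Ha ltac:(intros [E|[]]; now apply Ha0) z Hz).
  rewrite <- (pseudohyp_mult_denom a z Ha Hz) in S.
  assert (P1 : 0 < Cmod (1 - Cconj a * z)%C) by now apply Cmod_gt_0, mob_denom_neq_0.
  assert (Hqa : Cmod (q a) <= 1) by now apply Hq.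
  assert (S1 : Cmod (q z - q a)%C <= pseudohyp a z * Cmod (1 - Cconj (q a) * q z)%C).
  { apply Rmult_le_reg_r with (Cmod (1 - Cconj a * z)%C); lra. }
  assert (T : Cmod (1 - Cconj (q a) * q z)%C
     <= (1 - Cmod (q a) ^ 2) + Cmod (q a) * Cmod (q z - q a)%C).
  { replace (1 - Cconj (q a) * q z)%C
      with (RtoC (1 - Cmod (q a) ^ 2) + - (Cconj (q a) * (q z - q a)))%C.
    2:{ rewrite RtoC_minus, Cmod2_conj. ring. }
    eapply Rle_trans; [apply Cmod_triangle |].
    rewrite Cmod_opp, Cmod_mult, Cmod_conj, Cmod_R, Rabs_right; [lra |].
    assert (B := Cmod_ge_0 (q a)). nra. }
  assert (P2 := Cmod_ge_0 (q a)). assert (P3 := Cmod_ge_0 (q z - q a)%C).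
  assert (P4 := pseudohyp_ge_0 a z). assert (P5 := Cmod_ge_0 (1 - Cconj (q a) * q z)%C).
  set (x := Cmod (q z - q a)%C) in *. set (k := Cmod (q a)) in *.
  assert (S2 : x <= r * ((1 - k ^ 2) + k * x)).
  { eapply Rle_trans; [exact S1 |]. apply Rmult_le_compat; assumption. }
  assert (S3 : r * (k * x) <= r * x) by (apply Rmult_le_compat_l; nra).
  apply Rmult_le_reg_r with (1 - r); [lra |].
  replace (r * (1 - k ^ 2) / (1 - r) * (1 - r)) with (r * (1 - k ^ 2)) by (field; lra). lra.
Qed.

(** * Orbits and the hyperbolic step *)

Lemma ln_le_sub_1 x : 0 < x -> ln x <= x - 1.
Proof.
  intro Hx. rewrite <- (ln_exp (x - 1)). apply ln_le; [exact Hx |].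
  assert (H := exp_ineq1_le (x - 1)). lra.
Qed.

Lemma artanh_bounds t : 0 <= t < 1 -> t / 2 <= artanh t <= t / (1 - t).
Proof.
  intro Ht. unfold artanh. split.
  - assert (H : ln ((1 - t) / (1 + t)) <= (1 - t) / (1 + t) - 1).
    { apply ln_le_sub_1, Rdiv_lt_0_compat; lra. }
    replace ((1 + t) / (1 - t)) with (/ ((1 - t) / (1 + t))) by (field; lra).
    rewrite ln_Rinv by (apply Rdiv_lt_0_compat; lra).
    assert (E : t <= 1 - (1 - t) / (1 + t)); [| lra].
    apply Rmult_le_reg_r with (1 + t); [lra |].
    replace ((1 - (1 - t) / (1 + t)) * (1 + t)) with (2 * t) by (field; lra). nra.
  - assert (H := ln_le_sub_1 ((1 + t) / (1 - t)) ltac:(apply Rdiv_lt_0_compat; lra)).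
    replace ((1 + t) / (1 - t) - 1) with (2 * (t / (1 - t))) in H by (field; lra). lra.
Qed.

Lemma pseudohyp_orbit_le f n j z w : holomorphic_self_map f -> unit_disc z -> unit_disc w ->
  pseudohyp (iterate f (j + n) z) (iterate f (j + n) w) <= pseudohyp (iterate f n z) (iterate f n w).
Proof.
  intros Hf Hz Hw. unfold iterate. rewrite !Nat.iter_add.
  apply (pseudohyp_contraction (iterate f j)); [now apply holomorphic_iterate | |];
    now apply (holomorphic_iterate f n Hf).
Qed.

Lemma pseudohyp_orbit_limit f z w : holomorphic_self_map f -> unit_disc z -> unit_disc w ->
  exists d : R, 0 <= d /\
    is_lim_seq (fun n => pseudohyp (iterate f n z) (iterate f n w)) d /\
    forall n, d <= pseudohyp (iterate f n z) (iterate f n w).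
Proof.
  intros Hf Hz Hw. set (u := fun n => pseudohyp (iterate f n z) (iterate f n w)).
  assert (Hdec : forall n, u (S n) <= u n) by (intro n; apply (pseudohyp_orbit_le f n 1); assumption).
  destruct (ex_finite_lim_seq_decr u 0 Hdec) as [d Hd]; [intro; apply pseudohyp_ge_0 |].
  exists d. split; [| split; [exact Hd |]].
  { change (Rbar_le 0 d). apply (is_lim_seq_le (fun _ => 0) u).
    - intro; apply pseudohyp_ge_0.
    - apply is_lim_seq_const.
    - exact Hd. }
  intro n. apply (is_lim_seq_decr_compare u); assumption.
Qed.

Lemma poincare_orbit_lim_0 f z w : holomorphic_self_map f -> unit_disc z -> unit_disc w ->
  is_lim_seq (fun n => poincare_dist (iterate f n z) (iterate f n w)) 0 <->
  is_lim_seq (fun n => pseudohyp (iterate f n z) (iterate f n w)) 0.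
Proof.
  intros Hf Hz Hw.
  set (u := fun n => pseudohyp (iterate f n z) (iterate f n w)).
  change (is_lim_seq (fun n => artanh (u n)) 0 <-> is_lim_seq u 0).
  assert (Hr := pseudohyp_lt_1 z w Hz Hw). set (r := pseudohyp z w) in *.
  assert (Hu : forall n, 0 <= u n <= r).
  { intro n. split; [apply pseudohyp_ge_0 |].
    assert (H := pseudohyp_orbit_le f 0 n z w Hf Hz Hw). rewrite Nat.add_0_r in H. exact H. }
  assert (Hb : forall n, u n / 2 <= artanh (u n) <= u n / (1 - u n)).
  { intro n. apply artanh_bounds. specialize (Hu n). lra. }
  split; intro H.
  - apply (is_lim_seq_le_le (fun _ => 0) _ (fun n => 2 * artanh (u n))).
    + intro n. specialize (Hu n). specialize (Hb n). lra.
    + apply is_lim_seq_const.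
    + replace (Finite 0) with (Rbar_mult 2 0) by (simpl; f_equal; ring).
      now apply is_lim_seq_scal_l.
  - apply (is_lim_seq_le_le (fun _ => 0) _ (fun n => / (1 - r) * u n)).
    + intro n. specialize (Hu n). specialize (Hb n). split; [lra |].
      eapply Rle_trans; [apply Hb |]. unfold Rdiv. rewrite Rmult_comm.
      apply Rmult_le_compat_r; [lra |]. apply Rinv_le_contravar; lra.
    + apply is_lim_seq_const.
    + replace (Finite 0) with (Rbar_mult (/ (1 - r)) 0) by (simpl; f_equal; ring).
      now apply is_lim_seq_scal_l.
Qed.

(** The limit [d] of the pseudo-hyperbolic steps exists by monotonicity, and
    [artanh t >= t / 2] bounds the hyperbolic step below by [d / 2]. *)
Lemma zero_step_pseudohyp f z : holomorphic_self_map f -> unit_disc z ->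
  hyperbolic_step f z = 0 ->
  is_lim_seq (fun n => pseudohyp (iterate f n z) (iterate f n (f z))) 0.
Proof.
  intros Hf Hz Hs.
  assert (Hfz := proj1 Hf z Hz).
  destruct (pseudohyp_orbit_limit f z (f z) Hf Hz Hfz) as (d & Hd0 & Hd & Hle).
  set (u := fun n => pseudohyp (iterate f n z) (iterate f n (f z))) in *.
  assert (H : Rbar_le (Lim_seq (fun _ => d / 2)) (hyperbolic_step f z)).
  { apply Lim_seq_le_loc. exists 0%nat. intros n _.
    apply Rle_trans with (u n / 2); [specialize (Hle n); fold (u n) in Hle; lra |].
    replace (iterate f (S n) z) with (iterate f n (f z))
      by (unfold iterate; now rewrite Nat.iter_succ_r).
    apply (artanh_bounds (u n)). split; [apply pseudohyp_ge_0 |].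
    apply pseudohyp_lt_1; now apply (holomorphic_iterate f n Hf). }
  rewrite Hs, Lim_seq_const in H. simpl in H.
  now replace 0 with d by lra.
Qed.

(** Suppose the orbits of [z] and [w] keep a distance [d > 0].  At a late time
    [k] their distance is so close to [d] that every further iterate [f^n] almost
    preserves it.  By rigidity [f^n] then shrinks the distance from [f^k z] to
    [f^(k+1) z] by at most a factor 4, uniformly in [n].  These points differ as [f]
    has no fixed point, so the steps of the orbit of [z] stay away from [0]. *)
Lemma orbits_merge_of_zero_step f z : holomorphic_self_map f ->
  (forall x, unit_disc x -> f x <> x) -> unit_disc z ->
  is_lim_seq (fun n => pseudohyp (iterate f n z) (iterate f n (f z))) 0 ->
  forall w, unit_disc w -> is_lim_seq (fun n => pseudohyp (iterate f n z) (iterate f n w)) 0.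
Proof.
  intros Hf Hfix Hz Hlim w Hw.
  assert (Hit := fun n => proj1 (holomorphic_iterate f n Hf)).
  destruct (pseudohyp_orbit_limit f z w Hf Hz Hw) as (d & Hd0 & Hd & Hle).
  destruct Hd0 as [Hd0| <-]; [| exact Hd].
  exfalso.
  set (r := pseudohyp w (f z)).
  assert (Hr : r < 1) by (apply pseudohyp_lt_1; [exact Hw | now apply Hf]).
  assert (Hr0 : 0 <= r) by apply pseudohyp_ge_0.
  (* With this contraction ratio the error term of schwarz_rigidity is at most
     1/2, which leaves at least 3/4 - 1/2 = 1/4. *)
  set (k0 := 1 - (1 - r) / 4).
  assert (Hk0 : 3 / 4 <= k0 < 1) by (unfold k0; lra).
  assert (Hk : exists k, pseudohyp (iterate f k z) (iterate f k w) * k0 < d).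
  { apply is_lim_seq_spec in Hd.
    assert (He : 0 < d / k0 - d).
    { assert (d < d / k0); [| lra]. apply Rmult_lt_reg_r with k0; [lra |].
      replace (d / k0 * k0) with d by (field; lra). nra. }
    destruct (Hd (mkposreal _ He)) as [k Hk]. exists k.
    specialize (Hk k (le_n k)). simpl in Hk. apply Rabs_lt_between in Hk.
    replace d with (d / k0 * k0) by (field; lra). apply Rmult_lt_compat_r; lra. }
  destruct Hk as [k Hk].
  set (x := iterate f k z) in *. set (y := iterate f k w) in *.
  assert (Hx : unit_disc x) by now apply Hit. assert (Hy : unit_disc y) by now apply Hit.
  assert (Hfx : unit_disc (f x)) by now apply Hf.
  set (a := mob x y). set (b := mob x (f x)).
  assert (Ha : unit_disc a) by now apply mob_disc.
  assert (Hb : unit_disc b) by now apply mob_disc.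
  assert (Hda : d <= Cmod a) by (apply (Hle k)).
  (* Uniform in k, so that k0 may be fixed before k. *)
  assert (Hab : pseudohyp a b <= r).
  { eapply Rle_trans; [apply (pseudohyp_contraction (mob x)); [now apply holomorphic_mob | |]; assumption |].
    replace (f x) with (iterate f k (f z))
      by (unfold x, iterate; now rewrite <- Nat.iter_succ_r).
    assert (H := pseudohyp_orbit_le f 0 k w (f z) Hf Hw (proj1 Hf z Hz)).
    rewrite Nat.add_0_r in H. exact H. }
  assert (Hb0 : 0 < Cmod b).
  { apply Cmod_gt_0. intro E. apply (Hfix x Hx).
    rewrite <- (mob_opp_mob x (f x) Hx Hfx). fold b. rewrite E. apply mob_opp_0. }
  assert (Hlow : forall n, Cmod b / 4 <=
    pseudohyp (iterate f (n + k) z) (iterate f (n + k) (f z))).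
  { intro n.
    (* The iterate f^n seen from f^k z, moved to 0 on both sides. *)
    set (H := fun v => mob (iterate f n x) (iterate f n (mob (- x) v))).
    assert (Hnx : unit_disc (iterate f n x)) by now apply Hit.
    assert (HH : holomorphic_self_map H).
    { apply (holomorphic_comp (mob (iterate f n x)) (fun v => iterate f n (mob (- x) v))).
      - now apply holomorphic_mob.
      - apply (holomorphic_comp (iterate f n) (mob (- x))); [now apply holomorphic_iterate |].
        now apply holomorphic_mob, opp_disc. }
    assert (H0 : H 0 = 0) by (unfold H; rewrite mob_opp_0; apply mob_0).
    assert (HHa : H a = mob (iterate f n x) (iterate f n y))
      by (unfold H, a; now rewrite mob_opp_mob).
    assert (HHb : H b = mob (iterate f n x) (iterate f n (f x)))
      by (unfold H, b; now rewrite mob_opp_mob).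
    assert (Ha0 : a <> 0) by (apply Cmod_gt_0; lra).
    assert (R := schwarz_rigidity H a b r HH H0 Ha Ha0 Hb Hab Hr).
    assert (Hq : k0 <= Cmod (H a / a)%C).
    { rewrite Cmod_div by assumption. apply Rmult_le_reg_r with (Cmod a); [lra |].
      replace (Cmod (H a) / Cmod a * Cmod a) with (Cmod (H a)) by (field; lra).
      rewrite HHa. specialize (Hle (n + k)%nat). unfold iterate in Hle.
      rewrite !Nat.iter_add in Hle.
      change (d <= Cmod (mob (iterate f n x) (iterate f n y))) in Hle.
      change (pseudohyp x y) with (Cmod a) in Hk. lra. }
    set (q := Cmod (H a / a)%C) in *.
    assert (Hbound : r * (1 - q ^ 2) / (1 - r) <= / 2).
    { apply Rmult_le_reg_r with (1 - r); [lra |].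
      replace (r * (1 - q ^ 2) / (1 - r) * (1 - r)) with (r * (1 - q ^ 2)) by (field; lra).
      assert (1 - q ^ 2 <= 2 * (1 - k0)) by nra.
      apply Rle_trans with (1 * (2 * (1 - k0))); [| unfold k0; lra].
      apply Rle_trans with (r * (2 * (1 - k0))).
      - apply Rmult_le_compat_l; lra.
      - apply Rmult_le_compat_r; lra. }
    assert (T := Cmod_le_add_sub (H a / a * b)%C (H b)).
    rewrite Cmod_minus_sym, Cmod_mult in T. fold q in T.
    assert (B1 : Cmod b * (r * (1 - q ^ 2) / (1 - r)) <= Cmod b * / 2)
      by (apply Rmult_le_compat_l; lra).
    assert (B2 : 3 / 4 * Cmod b <= q * Cmod b) by (apply Rmult_le_compat_r; lra).
    rewrite HHb in *.
    unfold iterate. rewrite !Nat.iter_add.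
    replace (Nat.iter k f (f z)) with (f x)
      by (unfold x, iterate; now rewrite <- Nat.iter_succ_r).
    change (Cmod b / 4 <= Cmod (mob (iterate f n x) (iterate f n (f x)))). lra. }
  apply is_lim_seq_spec in Hlim.
  assert (Hb4 : 0 < Cmod b / 4) by lra.
  destruct (Hlim (mkposreal _ Hb4)) as [N HN]. simpl in HN.
  specialize (HN (N + k)%nat ltac:(lia)). specialize (Hlow N).
  rewrite Rminus_0_r in HN. apply Rabs_lt_between in HN. lra.
Qed.

(** * Left straightenings *)

Lemma Cmod_sub_le_pseudohyp a z : unit_disc a -> unit_disc z -> Cmod (z - a)%C <= 2 * pseudohyp a z.
Proof.
  intros Ha Hz. rewrite <- (pseudohyp_mult_denom a z Ha Hz), Rmult_comm.
  apply Rmult_le_compat_r; [apply pseudohyp_ge_0 |].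
  now apply mob_denom_le_2.
Qed.

Lemma compact_singleton (z : C) : compact_set (fun w => w = z).
Proof.
  intros I U _ HU. destruct (HU z eq_refl) as [i Hi]. exists (i :: nil).
  intros w ->. exists i. split; [now left | exact Hi].
Qed.

Lemma open_disc_radius (s : R) : open (fun z : C => Cmod z < s).
Proof.
  intros z Hz.
  assert (He : 0 < (s - Cmod z) / 2) by lra.
  exists (mkposreal _ He). intros w Hw.
  assert (H := C_NormedModule_mixin_compat2 z w (mkposreal _ He) Hw). simpl in H.
  change (Cmod (w - z)%C < sqrt 2 * ((s - Cmod z) / 2)) in H.
  assert (Hs : sqrt 2 < 2) by apply sqrt2_lt_2.
  assert (T := Cmod_le_add_sub w z). nra.
Qed.

Lemma compact_in_disc K : compact_set K -> (forall z, K z -> unit_disc z) ->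
  exists s, 0 <= s < 1 /\ forall z, K z -> Cmod z <= s.
Proof.
  intros HK Hsub.
  (* Radii s >= 1 give empty members of the cover. *)
  destruct (HK R (fun s z => s < 1 /\ Cmod z < s)) as [l Hl].
  - intro s. destruct (Rlt_dec s 1) as [Hs|Hs].
    + apply (open_ext (fun z : C => Cmod z < s)); [intro; tauto | apply open_disc_radius].
    + apply (open_ext (fun z : C => False)); [intro; tauto | apply open_false].
  - intros z Hz. specialize (Hsub z Hz). unfold unit_disc in Hsub.
    exists ((1 + Cmod z) / 2). lra.
  - assert (H : exists s, 0 <= s < 1 /\ forall t, In t l -> t < 1 -> t <= s).
    { clear Hl. induction l as [|t l (s & Hs & IH)].
      - exists 0. split; [lra | intros t []].
      - destruct (Rlt_dec t 1) as [Ht|Ht].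
        + exists (Rmax s t). split.
          * split; [eapply Rle_trans; [apply Hs | apply Rmax_l] | apply Rmax_lub_lt; lra].
          * intros t' [<-|Ht'] Ht1; [apply Rmax_r |].
            eapply Rle_trans; [now apply IH | apply Rmax_l].
        + exists s. split; [exact Hs |]. intros t' [<-|Ht'] Ht1; [lra | now apply IH]. }
    destruct H as (s & Hs & H). exists s. split; [exact Hs |].
    intros z Hz. destruct (Hl z Hz) as (t & Ht & Ht1 & Hzt).
    specialize (H t Ht Ht1). lra.
Qed.

(** Automorphisms do not increase the pseudo-hyperbolic distance, so the
    straightened iterates of two points merge when the iterates do. *)
Lemma straightening_constant f z h : holomorphic_self_map f -> unit_disc z ->
  (forall w, unit_disc w -> is_lim_seq (fun n => pseudohyp (iterate f n z) (iterate f n w)) 0) ->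
  left_straightening f h -> constant_on_disc h.
Proof.
  intros Hf Hz Hlim (Hh & gamma & Hcv).
  exists (h z). intros w Hw. apply Cmod_minus_eq_0.
  assert (Hpt : forall v, unit_disc v -> ccvg (fun n => aut_inv (gamma n) (iterate f n v)) (h v)).
  { intros v Hv eps He.
    destruct (Hcv _ (compact_singleton v)) with (eps := eps) as [N HN];
      [now intros ? -> | exact He |].
    exists N. intros n Hn. now apply HN. }
  apply Rle_antisym; [| apply Cmod_ge_0]. apply le_epsilon. intros eps He.
  destruct (Hpt z Hz (eps / 3)) as [N1 H1]; [lra |].
  destruct (Hpt w Hw (eps / 3)) as [N2 H2]; [lra |].
  assert (He6 : 0 < eps / 6) by lra.
  specialize (Hlim w Hw). apply is_lim_seq_spec in Hlim.
  destruct (Hlim (mkposreal _ He6)) as [N3 H3]. simpl in H3.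
  set (n := max N1 (max N2 N3)).
  specialize (H1 n ltac:(unfold n; lia)). specialize (H2 n ltac:(unfold n; lia)).
  specialize (H3 n ltac:(unfold n; lia)).
  rewrite Rminus_0_r in H3. apply Rabs_lt_between in H3.
  assert (Hz' := proj1 (holomorphic_iterate f n Hf) z Hz).
  assert (Hw' := proj1 (holomorphic_iterate f n Hf) w Hw).
  assert (Hg := aut_inv_holomorphic (gamma n)).
  assert (B := pseudohyp_contraction _ _ _ Hg Hz' Hw').
  assert (B2 := Cmod_sub_le_pseudohyp _ _ (proj1 Hg _ Hz') (proj1 Hg _ Hw')).
  set (gz := aut_inv (gamma n) (iterate f n z)) in *.
  set (gw := aut_inv (gamma n) (iterate f n w)) in *.
  rewrite Cmod_minus_sym in H2.
  assert (T1 := Cmod_triangle_sub (h w) gw (h z)).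
  assert (T2 := Cmod_triangle_sub gw gz (h z)). lra.
Qed.

Lemma unit_mult_conj c : Cmod c = 1 -> (c * Cconj c)%C = 1.
Proof. intro H. rewrite <- Cmod2_conj, H. f_equal. ring. Qed.

Lemma holomorphic_rotation c : Cmod c = 1 -> holomorphic_self_map (fun z => c * z)%C.
Proof.
  intro Hc. apply holomorphic_of_cdiff.
  - intros z Hz. unfold unit_disc. now rewrite Cmod_mult, Hc, Rmult_1_l.
  - intros z _. eexists. apply cdiff_mult; [apply cdiff_const | apply cdiff_id].
Qed.

Lemma centering_aut (a c : C) : unit_disc a -> Cmod c = 1 ->
  { A : disc_aut | forall z, aut_inv A z = (c * mob a z)%C }.
Proof.
  intros Ha Hc.
  assert (Hc' : Cmod (Cconj c) = 1) by now rewrite Cmod_conj.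
  assert (H1 : holomorphic_self_map (fun z => mob (- a) (Cconj c * z))).
  { apply (holomorphic_comp (mob (- a)) (fun z => Cconj c * z)%C).
    - now apply holomorphic_mob, opp_disc.
    - now apply holomorphic_rotation. }
  assert (H2 : holomorphic_self_map (fun z => c * mob a z)%C).
  { apply (holomorphic_comp (fun z => c * z)%C (mob a)).
    - now apply holomorphic_rotation.
    - now apply holomorphic_mob. }
  unshelve eexists (DiscAut _ _ H1 H2 _ _); [| | reflexivity].
  - intros z Hz. simpl. rewrite mob_mob_opp; [| exact Ha |].
    + now rewrite Cmult_assoc, unit_mult_conj, Cmult_1_l.
    + now apply (holomorphic_rotation (Cconj c) Hc').
  - intros z Hz. simpl.
    rewrite Cmult_assoc, (Cmult_comm (Cconj c)), unit_mult_conj, Cmult_1_l by exact Hc.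
    now apply mob_opp_mob.
Qed.

Lemma pseudohyp_bound_on_disc w s : unit_disc w -> 0 <= s < 1 ->
  exists r, 0 <= r < 1 /\ forall z, Cmod z <= s -> pseudohyp w z <= r.
Proof.
  intros Hw Hs. unfold unit_disc in Hw. assert (Hw0 := Cmod_ge_0 w).
  set (e := (1 - Cmod w ^ 2) * (1 - s ^ 2) / 4).
  assert (Pw : 0 < 1 - Cmod w ^ 2) by nra. assert (Ps : 0 < 1 - s ^ 2) by nra.
  assert (P := Rmult_lt_0_compat _ _ Pw Ps).
  assert (P' : (1 - Cmod w ^ 2) * (1 - s ^ 2) <= 1 * 1).
  { assert (Qw := pow2_ge_0 (Cmod w)). assert (Qs := pow2_ge_0 s).
    apply Rmult_le_compat; lra. }
  assert (He : 0 < e < 1) by (unfold e; lra).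
  exists (sqrt (1 - e)). split.
  { split; [apply sqrt_pos |]. rewrite <- sqrt_1 at 2. apply sqrt_lt_1; lra. }
  intros z Hz.
  assert (Hzd : unit_disc z) by (unfold unit_disc; lra).
  assert (H := one_sub_pseudohyp_sq w z Hw Hzd).
  assert (Hr := pseudohyp_lt_1 w z Hw Hzd). assert (Hr0 := pseudohyp_ge_0 w z).
  apply Rsqr_incr_0; [| exact Hr0 | apply sqrt_pos].
  rewrite Rsqr_sqrt by lra. unfold Rsqr.
  assert (HD := mob_denom_le_2 w z Hw Hzd).
  assert (HD0 := Cmod_ge_0 (1 - Cconj w * z)%C).
  assert (HD2 : Cmod (1 - Cconj w * z)%C ^ 2 <= 4) by nra.
  assert (B1 : (1 - pseudohyp w z ^ 2) * Cmod (1 - Cconj w * z)%C ^ 2 <= (1 - pseudohyp w z ^ 2) * 4)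
    by (apply Rmult_le_compat_l; nra).
  assert (B2 : (1 - Cmod w ^ 2) * (1 - s ^ 2) <= (1 - Cmod w ^ 2) * (1 - Cmod z ^ 2)).
  { apply Rmult_le_compat_l; [nra |]. assert (H2 := Cmod_ge_0 z). nra. }
  unfold e. nra.
Qed.

(** Normalise [g n = gamma_n^-1 o f^n] by [g n z0 = 0] and [g n w0 = u n > 0],
    the distance of the two orbits at time [n].  Then [g (k + n) = H o g n],
    where [H] fixes [0] and moves [u n] to [u (k + n)].  Since [u n] decreases to
    [d > 0], the ratio of these numbers is positive and tends to [1] uniformly
    in [k], so by rigidity [H] tends to the identity, locally uniformly.  Hence
    [g n] is locally uniformly Cauchy; its limit separates [z0] from [w0]. *)
Lemma nonconstant_straightening f z0 w0 d : holomorphic_self_map f ->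
  unit_disc z0 -> unit_disc w0 -> 0 < d ->
  is_lim_seq (fun n => pseudohyp (iterate f n z0) (iterate f n w0)) d ->
  (forall n, d <= pseudohyp (iterate f n z0) (iterate f n w0)) ->
  exists h, left_straightening f h /\ ~ constant_on_disc h.
Proof.
  intros Hf Hz0 Hw0 Hd Hlim Hle.
  set (u := fun n => pseudohyp (iterate f n z0) (iterate f n w0)) in *.
  change (forall n, d <= u n) in Hle.
  assert (Hit := fun n => proj1 (holomorphic_iterate f n Hf)).
  set (m := fun n => mob (iterate f n z0) (iterate f n w0)).
  (* The rotation that makes the image of w0 positive. *)
  set (c := fun n => (Cconj (m n) / RtoC (u n))%C).
  assert (Hup : forall n, 0 < u n) by (intro n; specialize (Hle n); lra).
  assert (HuC : forall n, RtoC (u n) <> 0).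
  { intros n E. specialize (Hup n). apply RtoC_inj in E. lra. }
  assert (Hc : forall n, Cmod (c n) = 1).
  { intro n. unfold c. rewrite Cmod_div, Cmod_conj, Cmod_R by apply HuC.
    specialize (Hup n). rewrite Rabs_right by lra.
    change (u n / u n = 1). field. lra. }
  set (gamma := fun n => proj1_sig (centering_aut (iterate f n z0) (c n) (Hit n z0 Hz0) (Hc n))).
  set (g := fun n z => aut_inv (gamma n) (iterate f n z)).
  assert (Eg : forall n z, g n z = (c n * mob (iterate f n z0) (iterate f n z))%C).
  { intros n z. unfold g, gamma. apply (proj2_sig (centering_aut _ _ _ _)). }
  assert (Hgh : forall n, holomorphic_self_map (g n)).
  { intro n. apply (holomorphic_comp (aut_inv (gamma n)) (iterate f n)).
    - apply aut_inv_holomorphic.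
    - now apply holomorphic_iterate. }
  assert (Hgmod : forall n z, unit_disc z -> Cmod (g n z) <= pseudohyp z0 z).
  { intros n z Hz. rewrite Eg, Cmod_mult, Hc, Rmult_1_l.
    apply (pseudohyp_contraction (iterate f n)); try assumption. now apply holomorphic_iterate. }
  assert (Hgz0 : forall n, g n z0 = 0) by (intro n; rewrite Eg, mob_0; ring).
  assert (Hgw0 : forall n, g n w0 = RtoC (u n)).
  { intro n. rewrite Eg. fold (m n). unfold c.
    transitivity (m n * Cconj (m n) / RtoC (u n))%C; [field; apply HuC |].
    rewrite <- Cmod2_conj. change (Cmod (m n)) with (u n).
    rewrite RtoC_pow. field. apply HuC. }
  (* Bounds 1 - u (k + n) / u n for all k. *)
  set (e := fun n => 1 - d / u n).
  assert (He : forall eps, 0 < eps -> exists N, forall n, (N <= n)%nat -> e n < eps).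
  { intros eps Heps. apply is_lim_seq_spec in Hlim.
    assert (Hde : 0 < d * eps) by (apply Rmult_lt_0_compat; lra).
    destruct (Hlim (mkposreal _ Hde)) as [N HN]. simpl in HN. exists N. intros n Hn.
    specialize (HN n Hn). apply Rabs_lt_between in HN. specialize (Hle n).
    unfold e. apply Rmult_lt_reg_r with (u n); [apply Hup |].
    replace ((1 - d / u n) * u n) with (u n - d) by (field; apply Rgt_not_eq, Hup).
    nra. }
  assert (Hcau : forall r z, r < 1 -> unit_disc z -> pseudohyp w0 z <= r -> forall n k,
    Cmod (g (k + n)%nat z - g n z)%C <= 3 * e n / (1 - r)).
  { intros r z Hr Hz Hrz n k.
    set (H := fun v => aut_inv (gamma (k + n)%nat) (iterate f k (aut_fun (gamma n) v))).
    assert (HH : holomorphic_self_map H).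
    { apply (holomorphic_comp (aut_inv (gamma (k + n)%nat))
        (fun v => iterate f k (aut_fun (gamma n) v))); [apply aut_inv_holomorphic |].
      apply (holomorphic_comp (iterate f k) (aut_fun (gamma n)));
        [now apply holomorphic_iterate | apply aut_fun_holomorphic]. }
    assert (EH : forall v, unit_disc v -> H (g n v) = g (k + n)%nat v).
    { intros v Hv. unfold H, g. rewrite aut_invK by now apply Hit.
      unfold iterate. now rewrite Nat.iter_add. }
    assert (H0 : H 0 = 0) by (rewrite <- (Hgz0 n) at 1; now rewrite EH).
    assert (Hgn := proj1 (Hgh n)).
    assert (Hrho : pseudohyp (g n w0) (g n z) <= r).
    { eapply Rle_trans; [| exact Hrz]. now apply pseudohyp_contraction. }
    assert (R := schwarz_rigidity H (g n w0) (g n z) r HH H0 (Hgn w0 Hw0)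
      ltac:(rewrite Hgw0; apply HuC) (Hgn z Hz) Hrho Hr).
    rewrite !EH, !Hgw0 in R by assumption.
    set (q := u (k + n)%nat / u n).
    assert (Hun := Hup n).
    replace (RtoC (u (k + n)%nat) / RtoC (u n))%C with (RtoC q) in R
      by (unfold q; rewrite RtoC_div; [reflexivity | lra]).
    assert (Hq1 : q <= 1).
    { unfold q. apply Rmult_le_reg_r with (u n); [exact Hun |].
      replace (u (k + n)%nat / u n * u n) with (u (k + n)%nat) by (field; lra).
      rewrite Rmult_1_l. now apply pseudohyp_orbit_le. }
    assert (Hq0 : 1 - q <= e n).
    { unfold e, q. assert (d / u n <= u (k + n)%nat / u n); [| lra].
      apply Rmult_le_compat_r; [left; now apply Rinv_0_lt_compat | apply Hle]. }
    assert (Hqp : 0 < q) by (apply Rdiv_lt_0_compat; apply Hup).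
    rewrite Cmod_R, Rabs_right in R by lra.
    assert (Hr0 : 0 <= r) by (eapply Rle_trans; [apply pseudohyp_ge_0 | exact Hrz]).
    assert (Hg1 := Hgn z Hz). unfold unit_disc in Hg1. assert (Hg0 := Cmod_ge_0 (g n z)).
    assert (Hinv : 1 <= / (1 - r)).
    { rewrite <- Rinv_1 at 1. apply Rinv_le_contravar; lra. }
    assert (Hq2 : 0 <= 1 - q ^ 2 <= 2 * e n) by (split; nra).
    assert (B1 : r * (1 - q ^ 2) / (1 - r) <= 2 * e n / (1 - r)).
    { apply Rmult_le_compat_r; [lra |]. rewrite <- (Rmult_1_l (2 * e n)).
      apply Rmult_le_compat; lra. }
    assert (B0 : 0 <= r * (1 - q ^ 2) / (1 - r)).
    { apply Rmult_le_pos; [apply Rmult_le_pos; lra | lra]. }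
    assert (T := Cmod_triangle_sub (g (k + n)%nat z) (q * g n z)%C (g n z)).
    replace (q * g n z - g n z)%C with (RtoC (q - 1) * g n z)%C in T
      by (rewrite RtoC_minus; ring).
    rewrite Cmod_mult, Cmod_R, Rabs_left1 in T by lra.
    assert (B2 : Cmod (g n z) * (r * (1 - q ^ 2) / (1 - r)) <= 2 * e n / (1 - r)) by nra.
    assert (B3 : - (q - 1) * Cmod (g n z) <= e n / (1 - r)).
    { apply Rle_trans with (e n * 1); [apply Rmult_le_compat; lra |].
      apply Rmult_le_compat_l; lra. }
    unfold Rdiv in *. lra. }
  assert (Hlimg : forall z, exists l, unit_disc z -> ccvg (fun n => g n z) l).
  { intro z. destruct (classic (unit_disc z)) as [Hz|Hz]; [| exists (RtoC 0); tauto].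
    assert (Hr := pseudohyp_lt_1 w0 z Hw0 Hz). set (r := pseudohyp w0 z) in *.
    destruct (ccvg_of_cauchy (fun n => g n z)) as [l Hl]; [| now exists l].
    intros eps Heps. destruct (He (eps * (1 - r) / 6)) as [N HN].
    { apply Rdiv_lt_0_compat; [apply Rmult_lt_0_compat; lra | lra]. }
    exists N. intros n k Hn Hk. specialize (HN N (le_n N)).
    assert (B : forall j, (N <= j)%nat -> Cmod (g j z - g N z)%C < eps / 2).
    { intros j Hj. assert (C1 := Hcau r z Hr Hz (Rle_refl _) N (j - N)%nat).
      replace (j - N + N)%nat with j in C1 by lia.
      eapply Rle_lt_trans; [exact C1 |].
      apply Rmult_lt_reg_r with (1 - r); [lra |].
      replace (3 * e N / (1 - r) * (1 - r)) with (3 * e N) by (field; lra). lra. }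
    assert (B1 := B n Hn). assert (B2 := B k Hk). rewrite Cmod_minus_sym in B2.
    assert (T := Cmod_triangle_sub (g n z) (g N z) (g k z)). lra. }
  destruct (functional_choice _ Hlimg) as [h Hh].
  assert (Hunif : forall s, 0 <= s < 1 -> forall eps, 0 < eps -> exists N, forall n, (N <= n)%nat ->
    forall z, Cmod z <= s -> Cmod (g n z - h z)%C < eps).
  { intros s Hs eps Heps.
    destruct (pseudohyp_bound_on_disc w0 s Hw0 Hs) as (r & Hr & Hrz).
    destruct (He (eps * (1 - r) / 3)) as [N HN].
    { apply Rdiv_lt_0_compat; [apply Rmult_lt_0_compat; lra | lra]. }
    exists N. intros n Hn z Hz. specialize (HN n Hn).
    assert (Hzd : unit_disc z) by (unfold unit_disc; lra).
    apply Rle_lt_trans with (3 * e n / (1 - r)).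
    - apply (ccvg_Cmod_sub_le (fun n => g n z) _ _ _ n (Hh z Hzd)).
      intros j Hj. rewrite Cmod_minus_sym.
      assert (C1 := Hcau r z (proj2 Hr) Hzd (Hrz z Hz) n (j - n)%nat).
      now replace (j - n + n)%nat with j in C1 by lia.
    - apply Rmult_lt_reg_r with (1 - r); [lra |].
      replace (3 * e n / (1 - r) * (1 - r)) with (3 * e n) by (field; lra). lra. }
  exists h. split; [split |].
  - apply holomorphic_of_cdiff.
    + intros z Hz. apply Rle_lt_trans with (pseudohyp z0 z); [| now apply pseudohyp_lt_1].
      replace (Cmod (h z)) with (Cmod (0 - h z)%C).
      2:{ rewrite <- Cmod_opp. f_equal. ring. }
      apply (ccvg_Cmod_sub_le (fun n => g n z) _ _ _ 0%nat (Hh z Hz)).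
      intros n _. replace (0 - g n z)%C with (- g n z)%C by ring.
      rewrite Cmod_opp. now apply Hgmod.
    + intros p Hp. unfold unit_disc in Hp. assert (Hp0 := Cmod_ge_0 p).
      assert (Hball : forall z, Cmod (z - p)%C <= (1 - Cmod p) / 2 -> Cmod z <= (1 + Cmod p) / 2).
      { intros z Hz. assert (T := Cmod_le_add_sub z p). lra. }
      apply (weierstrass_differentiable g h p ((1 - Cmod p) / 2)); [lra | |].
      * intros n z Hz. apply holomorphic_cdiff; [apply Hgh |].
        specialize (Hball z Hz). unfold unit_disc. lra.
      * intros eps Heps.
        destruct (Hunif ((1 + Cmod p) / 2) ltac:(lra) eps Heps) as [N HN].
        exists N. intros n Hn z Hz. apply HN; auto.
  - exists gamma. intros K HK HKd eps Heps.
    destruct (compact_in_disc K HK HKd) as (s & Hs & HKs).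
    destruct (Hunif s Hs eps Heps) as [N HN].
    exists N. intros n Hn z Hz. apply (HN n Hn z). now apply HKs.
  - intros [k Hk].
    assert (E : h z0 = h w0) by now rewrite !Hk.
    assert (L0 : Cmod (0 - h z0)%C <= 0).
    { apply (ccvg_Cmod_sub_le (fun n => g n z0) _ _ _ 0%nat (Hh z0 Hz0)).
      intros n _. rewrite Hgz0, Cminus_diag, Cmod_0. lra. }
    destruct (Hh w0 Hw0 d Hd) as [N HN]. specialize (HN N (le_n N)).
    rewrite <- E, Hgw0 in HN.
    assert (T := Cmod_le_add_sub (u N) (h z0)).
    rewrite Cmod_R, Rabs_right in T by (specialize (Hup N); lra).
    replace (0 - h z0)%C with (- h z0)%C in L0 by ring. rewrite Cmod_opp in L0.
    specialize (Hle N). lra.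
Qed.

Theorem theorem4 (f : C -> C)
  (f_hol : holomorphic_self_map f)
  (f_nofix : forall z : C, unit_disc z -> f z <> z) :
  let stmt_i := exists z0 : C, unit_disc z0 /\ hyperbolic_step f z0 = Finite 0 in
  let stmt_ii := forall h : C -> C, left_straightening f h -> constant_on_disc h in
  let stmt_iii := forall z w : C, unit_disc z -> unit_disc w ->
    is_lim_seq (fun n => poincare_dist (iterate f n z) (iterate f n w)) (Finite 0) in
  let stmt_iv := forall z : C, unit_disc z -> hyperbolic_step f z = Finite 0 in
  (stmt_i <-> stmt_ii) /\ (stmt_ii <-> stmt_iii) /\ (stmt_iii <-> stmt_iv).
Proof.
  intros stmt_i stmt_ii stmt_iii stmt_iv.
  assert (i_ii : stmt_i -> stmt_ii).
  { intros (z0 & Hz0 & Hs) h Hh.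
    apply (straightening_constant f z0 h f_hol Hz0); [| exact Hh].
    apply orbits_merge_of_zero_step; try assumption. now apply zero_step_pseudohyp. }
  assert (ii_iii : stmt_ii -> stmt_iii).
  { intros Hii z w Hz Hw. apply poincare_orbit_lim_0; try assumption.
    destruct (pseudohyp_orbit_limit f z w f_hol Hz Hw) as (d & Hd0 & Hd & Hle).
    destruct Hd0 as [Hd0| <-]; [| exact Hd].
    destruct (nonconstant_straightening f z w d f_hol Hz Hw Hd0 Hd Hle) as (h & Hh & Hn).
    destruct Hn. now apply Hii. }
  assert (iii_iv : stmt_iii -> stmt_iv).
  { intros Hiii z Hz. apply is_lim_seq_unique.
    apply (is_lim_seq_ext (fun n => poincare_dist (iterate f n z) (iterate f n (f z)))).
    - intro n. unfold iterate. now rewrite Nat.iter_succ_r.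
    - apply Hiii; [exact Hz | now apply f_hol]. }
  assert (iv_i : stmt_iv -> stmt_i).
  { intro Hiv. exists (RtoC 0). split; [apply zero_disc | apply Hiv, zero_disc]. }
  tauto.
Qed.
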